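(* Let $\aleph$ be an infinite cardinal, $\mathbb K$ a field, and $I$ an $\aleph$-poset having a finite cofinal subset. If $J$ is any subset of $I$, then the $\mathbb K$-algebra $H(I,J)$ is locally matricial. In particular $\mathfrak B(I)$ is locally matricial.
   Context: A matricial $\mathbb K$-algebra is an algebra isomorphic to $\mathbb M_{n_1}(\mathbb K)\times\cdots\times\mathbb M_{n_r}(\mathbb K)$ for some positive integers $n_1,\dots,n_r$ (the case $r=0$, the zero algebra, being allowed). A (not necessarily unital) $\mathbb K$-algebra $R$ is locally matricial if every finite subset of $R$ is contained in some matricial $\mathbb K$-subalgebra of $R$ (whose identity need not be that of $R$). Conventions. $\aleph$ is an infinite cardinal, regarded as an initial ordinal, so that $\emptyset\in\aleph$; $\mathbb K$ is a field. For a poset $P$, $\mathcal M(P)$ is the set of all maximal chains of $P$ (maximal totally ordered subsets). An $\aleph$-poset is a partially ordered set $I$ with $|I|\le\aleph$ and $|\mathcal M(I)|\le\aleph$. For $i\in I$: $\{i\le\}=\{k\in I: i\le k\}$, $\{\le i\}=\{k\in I:k\le i\}$, $\{i\not\le\}=I\setminus\{i\le\}$, with the induced orders. For a set $A$, $\aleph^{(A)}$ is the set of maps $p:A\to\aleph$ with $p(a)=\emptyset$ for all but finitely many $a\in A$. For a set $X$, $\mathrm{CFM}_X(\mathbb K)$ is the $\mathbb K$-algebra of column-finite $X\times X$ matrices over $\mathbb K$, and $\mathrm{FR}_X(\mathbb K)$ is its ideal of matrices with only finitely many nonzero rows; $a(x,y)$ denotes the entry of $a$ in row $x$, column $y$.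 Construction. Let $X(I)=\aleph^{(I)}\times\mathcal M(I)$ and $Q(I)=\mathrm{CFM}_{X(I)}(\mathbb K)$. For $i\in I$ let $X(i\le)=\aleph^{(\{i\le\})}\times\mathcal M(\{i\le\})$ and let $\psi_{I,i}:\mathrm{CFM}_{X(i\le)}(\mathbb K)\to Q(I)$ be the injective (not necessarily unital) $\mathbb K$-algebra homomorphism given, for $p,q\in\aleph^{(I)}$ and $A,B\in\mathcal M(I)$, by $$\psi_{I,i}(a)((p,A),(q,B))=a\big((p|_{\{i\le\}},A\cap\{i\le\}),(q|_{\{i\le\}},B\cap\{i\le\})\big)$$ if $i\in A\cap B$, $A\cap\{\le i\}=B\cap\{\le i\}$ and $p|_{\{i\not\le\}}=q|_{\{i\not\le\}}$, and $\psi_{I,i}(a)((p,A),(q,B))=0$ otherwise. Put $H(I,i)=\psi_{I,i}(\mathrm{FR}_{X(i\le)}(\mathbb K))$ if $i$ is not a maximal element of $I$, and $H(I,i)=\mathbb K\,\psi_{I,i}(\mathbf 1)$ if $i$ is a maximal element of $I$. For $J\subseteq I$ put $H(I,J)=\sum_{j\in J}H(I,j)\subseteq Q(I)$; this sum is direct and $H(I,J)$ is a (not necessarily unital) $\mathbb K$-subalgebra of $Q(I)$. Finally $\mathfrak B(I)=H(I,I)$, which is a unital subalgebra of $Q(I)$ when $I$ has a finite cofinal subset. *)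

(* Defs.v *)
From HB Require Import structures.
From mathcomp Require Import all_boot all_order all_algebra finmap.
From mathcomp Require Import boolp classical_sets functions cardinality fsbigop.
From mathcomp Require wochoice.

Set Implicit Arguments.
Unset Strict Implicit.
Unset Printing Implicit Defensive.

Import Order.TTheory GRing.Theory.

Local Open Scope classical_set_scope.
Local Open Scope card_scope.
Local Open Scope ring_scope.

Definition col_finite (X : Type) (K : fieldType) : {pred X -> X -> K} :=
  fun a => `[< forall y, finite_set [set x | a x y != 0] >].

(* [cfm X K] is CFM_X(K); [a x y] is the entry in row [x], column [y]. *)
Record cfm (X : Type) (K : fieldType) :=
  CFM { cfm_val :> X -> X -> K; cfmP : cfm_val \in @col_finite X K }.

HB.instance Definition _ X K := [isSub for @cfm_val X K].
HB.instance Definition _ X K := [Choice of cfm X K by <:].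

Section ColumnFiniteModule.
Variables (X : Type) (K : fieldType).
Implicit Types a b : cfm X K.

Lemma cfm_col_finite a y : finite_set [set x | a x y != 0].
Proof. by have /asboolP := cfmP a. Qed.

Lemma cfm_eqP a b : (forall x y, a x y = b x y) <-> a = b.
Proof.
split=> [ab|-> //]; apply: val_inj => /=.
by apply/funext => x; apply/funext => y.
Qed.

Lemma col_finite_zmod_closed : zmod_closed (@col_finite X K).
Proof.
split=> [|a b /asboolP fa /asboolP fb]; apply/asboolP => y.
  by apply: (sub_finite_set (B := set0)) => // x /=; rewrite eqxx.
apply: (sub_finite_set (B := [set x | a x y != 0] `|` [set x | b x y != 0])).
  move=> x; rewrite /= -[(a - b) x y]/(a x y - b x y).
  have [-> /=|] := eqVneq (a x y) 0; last by left.
  by have [->|] := eqVneq (b x y) 0; [rewrite subrr eqxx|right].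
by rewrite finite_setU.
Qed.

HB.instance Definition _ :=
  GRing.isZmodClosed.Build (X -> X -> K) (@col_finite X K)
    col_finite_zmod_closed.
HB.instance Definition _ := [SubChoice_isSubZmodule of cfm X K by <:].

Lemma cfm_addE a b x y : (a + b) x y = a x y + b x y.
Proof. by []. Qed.

Lemma cfm_scale_subproof (c : K) a : (fun x y => c * a x y) \in @col_finite X K.
Proof.
apply/asboolP => y; apply: sub_finite_set (cfm_col_finite a y) => x /=.
by apply: contra_neq => ->; rewrite mulr0.
Qed.

Definition cfm_scale c a := CFM (cfm_scale_subproof c a).

Fact cfm_scaleA c1 c2 a : cfm_scale c1 (cfm_scale c2 a) = cfm_scale (c1 * c2) a.
Proof. by apply/cfm_eqP => x y /=; rewrite mulrA. Qed.
Fact cfm_scale1 : left_id 1 cfm_scale.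
Proof. by move=> a; apply/cfm_eqP => x y /=; rewrite mul1r. Qed.
Fact cfm_scaleDr : right_distributive cfm_scale +%R.
Proof. by move=> c a b; apply/cfm_eqP => x y; rewrite /= !fctE mulrDr. Qed.
Fact cfm_scaleDl a : {morph cfm_scale^~ a : c1 c2 / c1 + c2}.
Proof. by move=> c1 c2; apply/cfm_eqP => x y; rewrite /= !fctE mulrDl. Qed.

HB.instance Definition _ := GRing.Zmodule_isLmodule.Build K (cfm X K)
  cfm_scaleA cfm_scale1 cfm_scaleDr cfm_scaleDl.

Lemma cfm_scaleE c a x y : (c *: a) x y = c * a x y.
Proof. by []. Qed.

End ColumnFiniteModule.

Section ColumnFiniteRing.
Variables (X : choiceType) (K : fieldType).
Implicit Types a b c : cfm X K.

Definition cfm_mul_fun a b x z : K := \sum_(y \in [set: X]) a x y * b y z.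

(* The defining sum of a product may be taken over any finite set of indices *)
(* containing the support of the relevant column of the right factor.        *)
Lemma cfm_mul_funE a b x z (B : {fset X}) :
  (forall y, b y z != 0 -> y \in B) ->
  cfm_mul_fun a b x z = \sum_(y <- B) a x y * b y z.
Proof.
move=> hB; apply: fsbigTE => y; apply: contraNeq => ab; apply: hB.
by apply: contra_neq ab => ->; rewrite mulr0.
Qed.

Lemma cfm_col_fset a y : exists B : {fset X}, forall x, a x y != 0 -> x \in B.
Proof.
by have /finite_fsetP[B eqB] := cfm_col_finite a y; exists B => x ax;
   have : [set` B] x by rewrite -eqB.
Qed.

Lemma cfm_cols_fset a (C : {fset X}) :
  exists B : {fset X}, forall x y, y \in C -> a x y != 0 -> x \in B.
Proof.
have /finite_fsetP[B eqB] :
    finite_set (\bigcup_(y in [set` C]) [set x | a x y != 0]).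
  by apply: bigcup_finite => // y _; exact: cfm_col_finite.
by exists B => x y yC ax; have : [set` B] x by rewrite -eqB; exists y.
Qed.

Lemma cfm_mul_subproof a b : cfm_mul_fun a b \in @col_finite X K.
Proof.
apply/asboolP => z; have [C hC] := cfm_col_fset b z.
have [B hB] := cfm_cols_fset a C.
apply: (finite_subfset B) => x /=; apply: contraNT => xB.
rewrite (cfm_mul_funE _ _ hC) big_seq big1 // => y yC.
suff -> : a x y = 0 by rewrite mul0r.
by apply: contraNeq xB => /(hB _ _ yC).
Qed.

Definition cfm_mul a b := CFM (cfm_mul_subproof a b).

Lemma cfm_one_subproof :
  (fun x y : X => (x == y)%:R : K) \in @col_finite X K.
Proof.
apply/asboolP => y; apply: (finite_subfset [fset y]%fset) => x /=.
by rewrite inE; case: (x == y) => //; rewrite eqxx.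
Qed.

Definition cfm_one := CFM cfm_one_subproof.

Fact cfm_mulA : associative cfm_mul.
Proof.
move=> a b c; apply/cfm_eqP => x w /=.
have [C hC] := cfm_col_fset c w; have [B hB] := cfm_cols_fset b C.
rewrite [RHS](cfm_mul_funE _ _ hC).
rewrite [LHS](@cfm_mul_funE _ _ _ _ B); last first.
  move=> y; apply: contraNT => yB /=.
  rewrite (cfm_mul_funE _ _ hC) big_seq big1 // => z zC.
  suff -> : b y z = 0 by rewrite mul0r.
  by apply: contraNeq yB => /(hB _ _ zC).
under eq_bigr => y _ do rewrite /= (cfm_mul_funE _ _ hC) mulr_sumr.
rewrite exchange_big /= big_seq [RHS]big_seq; apply: eq_bigr => z zC.
rewrite (@cfm_mul_funE _ _ _ _ B); last by move=> y; exact: hB.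
by rewrite mulr_suml; apply: eq_bigr => y _; rewrite mulrA.
Qed.

Fact cfm_mul1 : left_id cfm_one cfm_mul.
Proof.
move=> a; apply/cfm_eqP => x z /=; rewrite /cfm_mul_fun.
rewrite (fsbigTE [fset x]%fset) ?big_seq_fset1 /= ?eqxx ?mul1r // => y.
by rewrite inE eq_sym => /negPf /= ->; rewrite mul0r.
Qed.

Fact cfm_mulr1 : right_id cfm_one cfm_mul.
Proof.
move=> a; apply/cfm_eqP => x z /=; rewrite /cfm_mul_fun.
rewrite (fsbigTE [fset z]%fset) ?big_seq_fset1 /= ?eqxx ?mulr1 // => y.
by rewrite inE => /negPf /= ->; rewrite mulr0.
Qed.

Fact cfm_mulDl : left_distributive cfm_mul +%R.
Proof.
move=> a b c; apply/cfm_eqP => x z; have [C hC] := cfm_col_fset c z.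
rewrite cfm_addE /= !(cfm_mul_funE _ _ hC) -big_split /=.
by apply: eq_bigr => y _; rewrite -mulrDl.
Qed.

Fact cfm_mulDr : right_distributive cfm_mul +%R.
Proof.
move=> a b c; apply/cfm_eqP => x z; rewrite cfm_addE /=.
have [B hB] := cfm_col_fset b z; have [C hC] := cfm_col_fset c z.
pose D := (B `|` C)%fset.
have hD y : (b + c) y z != 0 -> y \in D.
  rewrite cfm_addE inE; apply: contraNT; rewrite negb_or => /andP[yB yC].
  have -> : b y z = 0 by apply: contraNeq yB => /hB.
  by have -> : c y z = 0 by [apply: contraNeq yC => /hC]; rewrite addr0.
rewrite (cfm_mul_funE _ _ hD) !(@cfm_mul_funE _ _ _ _ D) -?big_split /=.
- by apply: eq_bigr => y _; rewrite -mulrDr.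
- by move=> y /hC yC; rewrite inE yC orbT.
- by move=> y /hB yB; rewrite inE yB.
Qed.

HB.instance Definition _ := GRing.Zmodule_isPzRing.Build (cfm X K)
  cfm_mulA cfm_mul1 cfm_mulr1 cfm_mulDl cfm_mulDr.

Lemma cfm_mulE a b x z :
  (a * b) x z = \sum_(y \in [set: X]) a x y * b y z.
Proof. by []. Qed.

Lemma cfm_oneE x y : (1 : cfm X K) x y = (x == y)%:R.
Proof. by []. Qed.

End ColumnFiniteRing.

(* The library's algebras are nontrivial rings, whence a nonempty index set. *)
Section ColumnFiniteAlgebra.
Variables (X : pointedType) (K : fieldType).

Fact cfm_one_neq0 : (1 : cfm X K) != 0.
Proof.
apply/eqP => /cfm_eqP /(_ point point); rewrite cfm_oneE eqxx.
by move/eqP; rewrite oner_eq0.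
Qed.

HB.instance Definition _ :=
  GRing.PzSemiRing_isNonZero.Build (cfm X K) cfm_one_neq0.

Fact cfm_scaleAl (c : K) (a b : cfm X K) : c *: (a * b) = (c *: a) * b.
Proof.
apply/cfm_eqP => x z; rewrite cfm_scaleE.
have [B hB] := cfm_col_fset b z.
rewrite !cfm_mulE -!/(cfm_mul_fun _ _ _ _) !(cfm_mul_funE _ _ hB).
by rewrite mulr_sumr; apply: eq_bigr => y _; rewrite cfm_scaleE mulrA.
Qed.

HB.instance Definition _ :=
  GRing.Lmodule_isLalgebra.Build K (cfm X K) cfm_scaleAl.

Fact cfm_scaleAr (c : K) (a b : cfm X K) : c *: (a * b) = a * (c *: b).
Proof.
apply/cfm_eqP => x z; rewrite cfm_scaleE.
have [B hB] := cfm_col_fset b z.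
rewrite !cfm_mulE -!/(cfm_mul_fun _ _ _ _) (cfm_mul_funE _ _ hB).
rewrite (@cfm_mul_funE _ _ _ _ _ _ B) ?mulr_sumr.
  by apply: eq_bigr => y _; rewrite cfm_scaleE mulrCA.
move=> y; rewrite cfm_scaleE => cb; apply: hB; apply: contra_neq cb => ->.
by rewrite mulr0.
Qed.

HB.instance Definition _ :=
  GRing.Lalgebra_isAlgebra.Build K (cfm X K) cfm_scaleAr.

End ColumnFiniteAlgebra.

Definition finite_rows (X : Type) (K : fieldType) : set (cfm X K) :=
  [set a | finite_set [set x | exists y, a x y != 0]].

Section LocallyMatricial.
Variables (K : fieldType) (A : algType K).

(* Subalgebras need not contain [1 : A], nor any identity at all. *)
Definition subalgebra (S : set A) : Prop :=
  [/\ S 0,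
      forall a b, S a -> S b -> S (a + b),
      forall (c : K) a, S a -> S (c *: a) &
      forall a b, S a -> S b -> S (a * b)].

Definition matricial (S : set A) : Prop :=
  subalgebra S /\
  exists (r : nat) (n : 'I_r -> nat) (f : (forall k, 'M[K]_(n k)) -> A),
    [/\ forall k, (0 < n k)%N,
        set_bij [set: forall k, 'M[K]_(n k)] S f,
        forall a b, f (fun k => a k + b k) = f a + f b,
        forall (c : K) a, f (fun k => c *: a k) = c *: f a &
        forall a b, f (fun k => a k *m b k) = f a * f b].

Definition locally_matricial (R : set A) : Prop :=
  subalgebra R /\
  forall F : set A, finite_set F -> F `<=` R ->
    exists S : set A, [/\ matricial S, F `<=` S & S `<=` R].

End LocallyMatricial.

(* An infinite initial ordinal is, up to isomorphism, an infinite well-order  *)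
(* that does not inject into any of its proper initial segments; its element  *)
(* given by the empty set is then the least one, [\bot].                      *)
Definition infinite_cardinal (da : Order.disp_t) (aleph : bOrderType da) :=
  [/\ infinite_set [set: aleph],
      wochoice.well_order (<=%O : rel aleph) &
      forall a : aleph, ~~ ([set: aleph] #<= [set b : aleph | (b < a)%O])].

Definition max_chains (d : Order.disp_t) (P : porderType d) : set (set P) :=
  [set A | total_on A (<=%O : rel P) /\
           forall B : set P, total_on B (<=%O : rel P) -> A `<=` B -> B = A].
Arguments max_chains {d} P.

Definition aleph_poset (da : Order.disp_t) (aleph : bOrderType da)
    (d : Order.disp_t) (I : porderType d) : Prop :=
  ([set: I] #<= [set: aleph]) /\ (max_chains I #<= [set: aleph]).

Definition cofinal (d : Order.disp_t) (I : porderType d) (F : set I) : Prop :=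
  forall i, exists2 j, F j & (i <= j)%O.

Definition up (d : Order.disp_t) (I : porderType d) (i : I) : Type :=
  {k : I | (i <= k)%O}.
HB.instance Definition _ d (I : porderType d) (i : I) :=
  SubChoice.on (up i).
HB.instance Definition _ d (I : porderType d) (i : I) :=
  [SubChoice_isSubPOrder of up i by <: with d].

(* [finsupp aleph A] is the set aleph^(A). *)
Definition finsupp (da : Order.disp_t) (aleph : bOrderType da) (A : Type) :
    set (A -> aleph) :=
  [set p | finite_set [set a | p a != \bot%O]].
Arguments finsupp {da} aleph A.

Section MaximalChains.
Variables (d : Order.disp_t) (P : porderType d).

Lemma max_chains_neq0 : exists A : set P, max_chains P A.
Proof.
pose ch (A : set P) := `[< total_on A (<=%O : rel P) >].
pose T := {A : set P | ch A}.
pose R : rel T := fun A B => `[< val A `<=` val B >].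
have [||||A maxA] := @Zorn T R.
- by move=> A; apply/asboolP.
- by move=> A B C /asboolP AB /asboolP BC; apply/asboolP; exact: subset_trans BC.
- move=> A B /asboolP AB /asboolP BA; apply: val_inj.
  by apply/seteqP; split.
- move=> F totF.
  have totU : total_on (\bigcup_(A in F) val A) (<=%O : rel P).
    move=> x y [A FA Ax] [B FB By].
    by case: (totF A B FA FB) => /asboolP AB;
      [have /asboolP := valP B|have /asboolP := valP A]; apply=> //; exact: AB.
  exists (exist ch _ (asboolT totU) : T) => A FA; apply/asboolP => x Ax.
  by exists A.
exists (val A); split; first by have /asboolP := valP A.
move=> B totB AB; have := maxA (exist ch B (asboolT totB) : T).
by move=> /(_ (asboolT AB)) <-.
Qed.

Lemma trace_max_chain (i : P) (A : set P) :
  max_chains P A -> A i -> max_chains (up i) [set k : up i | A (val k)].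
Proof.
move=> [totA maxA] Ai; split=> [x y /= Ax Ay|C totC subC]; first exact: totA.
have sub k : A k -> forall ik : (i <= k)%O, C (exist _ k ik).
  by move=> Ak ik; apply: subC.
have AC x (y : up i) : A x -> C y -> (x <= val y)%O \/ (val y <= x)%O.
  move=> Ax Cy; have [xi|ix] := totA _ _ Ax Ai.
    by left; exact: le_trans xi (valP y).
  exact: totC (exist _ x ix) y (sub _ Ax ix) Cy.
have totAC : total_on (A `|` val @` C) (<=%O : rel P).
  move=> x y [Ax|[u Cu <-]] [Ay|[v Cv <-]].
  - exact: totA.
  - exact: AC.
  - by case: (AC _ _ Ay Cu); [right|left].
  - exact: totC.
apply/seteqP; split=> // k Ck /=.
by rewrite -(maxA _ totAC); [right; exists k|left].
Qed.

End MaximalChains.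

(* [Xidx aleph P] is the set X(P) = aleph^(P) x M(P). *)
Definition Xidx (da : Order.disp_t) (aleph : bOrderType da)
    (d : Order.disp_t) (P : porderType d) : Type :=
  (set_type (finsupp aleph P) * set_type (max_chains P))%type.
Arguments Xidx {da} aleph {d} P.

Section IndexPointed.
Variables (da : Order.disp_t) (aleph : bOrderType da).
Variables (d : Order.disp_t) (P : porderType d).

HB.instance Definition _ := Choice.on (Xidx aleph P).

Fact cst_bot_finsupp : finsupp aleph P (fun=> \bot%O).
Proof. by apply: (sub_finite_set (B := set0)) => // x /=; rewrite eqxx. Qed.

Definition Xidx_point : Xidx aleph P :=
  (SigSub (mem_set cst_bot_finsupp),
   SigSub (mem_set (projT2 (cid (max_chains_neq0 P))))).

HB.instance Definition _ := isPointed.Build (Xidx aleph P) Xidx_point.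

End IndexPointed.

Section Construction.
Variables (da : Order.disp_t) (aleph : bOrderType da) (K : fieldType).
Variables (d : Order.disp_t) (I : porderType d).
Implicit Types (i : I) (x y : Xidx aleph I).

Definition Qalg := cfm (Xidx aleph I) K.
HB.instance Definition _ := GRing.Algebra.on Qalg.

Definition idx_map x : I -> aleph := val x.1.
Definition idx_chain x : set I := val x.2.

Lemma restr_finsupp i x : finsupp aleph (up i) (fun k => idx_map x (val k)).
Proof.
have fx : finite_set [set k | idx_map x k != \bot%O] by exact: set_valP x.1.
apply: (finite_preimage (f := fun k : up i => val k) _ fx).
by move=> k l _ _; exact: val_inj.
Qed.

(* Defined only when [i] is in the chain of [x], since the trace on {i <=} of *)
(* a maximal chain avoiding [i] need not be a maximal chain of {i <=}.        *)
Definition restr i x (ix : idx_chain x i) : Xidx aleph (up i) :=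
  (SigSub (mem_set (restr_finsupp i x)),
   SigSub (mem_set (trace_max_chain (set_valP x.2) ix))).

Definition compatible i x y : Prop :=
  [/\ [set k | idx_chain x k /\ (k <= i)%O] =
        [set k | idx_chain y k /\ (k <= i)%O] &
      forall k, ~~ (i <= k)%O -> idx_map x k = idx_map y k].

Definition psi_fun i (a : cfm (Xidx aleph (up i)) K) x y : K :=
  match pselect (idx_chain x i), pselect (idx_chain y i),
        pselect (compatible i x y) with
  | left ix, left iy, left _ => a (restr ix) (restr iy)
  | _, _, _ => 0
  end.

Lemma restr_inj i x x' (ix : idx_chain x i) (ix' : idx_chain x' i) :
  compatible i x x' -> restr ix = restr ix' -> x = x'.
Proof.
case: x x' => [p A] [p' A'] in ix ix' *.
move=> [chE mapE] [] /= mE cE.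
congr pair; apply: val_inj => /=.
  apply/funext => k; have [ik|/mapE//] := boolP (i <= k)%O.
  exact: (congr1 (fun f => f (exist _ k ik : up i)) mE).
have eqch k : val A k = val A' k.
  have [ik|ik] := pselect (i <= k)%O.
    exact: (congr1 (fun S : set _ => S (exist _ k ik : up i)) cE).
  apply/propext; split=> Ak.
    have [ki|//] := (set_valP A).1 _ _ Ak ix.
    by have [] : [set k | idx_chain (p', A') k /\ (k <= i)%O] k by rewrite -chE.
  have [ki|//] := (set_valP A').1 _ _ Ak ix'.
  by have [] : [set k | idx_chain (p, A) k /\ (k <= i)%O] k by rewrite chE.
by apply/funext => k; rewrite eqch.
Qed.

Lemma psi_subproof i (a : cfm (Xidx aleph (up i)) K) :
  psi_fun a \in @col_finite (Xidx aleph I) K.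
Proof.
apply/asboolP => y.
have [iy|niy] := pselect (idx_chain y i); last first.
  apply: (sub_finite_set (B := set0)) => // x /=; rewrite /psi_fun.
  by case: pselect => // ?; [case: pselect => // ?|]; rewrite eqxx.
pose D := [set x | idx_chain x i /\ compatible i x y].
pose g x : Xidx aleph (up i) :=
  if pselect (idx_chain x i) is left ix then restr ix else point.
apply: (@sub_finite_set _ _ (D `&` g @^-1` [set z | a z (restr iy) != 0])).
  move=> x /=; rewrite /psi_fun /g /D /=.
  case: pselect => [ix|?]; last by rewrite eqxx.
  case: pselect => [iy'|//]; case: pselect => [c|?]; last by rewrite eqxx.
  by rewrite (Prop_irrelevance iy' iy).
have [h hP] : exists h : Xidx aleph (up i) -> Xidx aleph I,
    forall x, D x -> h (g x) = x.
  exists (fun z => if pselect (exists x, D x /\ g x = z) is left e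
                   then projT1 (cid e) else point) => x Dx.
  case: pselect => [e|[]]; last by exists x.
  case: cid => x' /= [[ix' [c1 c2]]]; move: Dx => [ix [c1' c2']].
  rewrite /g; case: pselect => // jx'; case: pselect => // jx E.
  apply: restr_inj E; split=> [|k ik]; first by rewrite c1 c1'.
  by rewrite c2 ?c2'.
apply: sub_finite_set (finite_image h (cfm_col_finite a (restr iy))).
by move=> x [Dx gx]; exists (g x) => //; exact: hP.
Qed.

Definition psi i (a : cfm (Xidx aleph (up i)) K) : Qalg :=
  CFM (psi_subproof a).

Definition H_at i : set Qalg :=
  [set b | (wochoice.maximal (<=%O : rel I) i /\
             exists c : K, b = c *: psi (1 : cfm (Xidx aleph (up i)) K)) \/
           (~ wochoice.maximal (<=%O : rel I) i /\
             exists2 a : cfm (Xidx aleph (up i)) K, finite_rows a & b = psi a)].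

Definition H_sum (J : set I) : set Qalg :=
  [set b | exists (s : seq I) (h : I -> Qalg),
     [/\ uniq s,
         forall j, j \in s -> J j /\ H_at j (h j) &
         b = \sum_(j <- s) h j]].

Definition frakB : set Qalg := H_sum [set: I].

End Construction.

Arguments Qalg {da} aleph K {d} I.
Arguments H_at {da} aleph K {d I} i.
Arguments H_sum {da} aleph K {d I} J.
Arguments frakB {da} aleph K {d} I.

(* Main.v *)
Require Import Defs.
From HB Require Import structures.
From mathcomp Require Import all_boot all_order all_algebra finmap.
From mathcomp Require Import boolp classical_sets functions cardinality fsbigop.
From mathcomp Require wochoice.

(* For [i <= j], multiplying [psi_j b] by the idempotent [psi_i 1] on either  *)
(* side gives an element of the image of [psi_i], so [H(i) H(j)] and          *)
(* [H(j) H(i)] lie in [H(i)], while these products vanish when [i] and [j]    *)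
(* are incomparable.                                                          *)
(* Hence for a minimal element [j] of a finite [J] the algebra [T := H(I,j)]  *)
(* is an ideal of [H(I,J)] complemented by [H(I,J \ j)], and one inducts on   *)
(* [J]. Every finite subset of [T] lies in a full matrix subalgebra of [T]    *)
(* ([T] is a copy of FR or of [K]); in particular [T] is von Neumann regular. *)
(* Given matrix units [e] spanning the part in [H(I,J \ j)], regularity gives *)
(* an idempotent [g] of [T] which commutes with [e] and is an identity for    *)
(* the given elements of [T]; the units [(1 - g) e] together with units of    *)
(* the corner of [g] in a full matrix subalgebra of [T] are as desired.       *)

Set Implicit Arguments.
Unset Strict Implicit.
Unset Printing Implicit Defensive.

Import Order.TTheory GRing.Theory.

Local Open Scope classical_set_scope.
Local Open Scope ring_scope.

(** H(I,J) is a sum of layers H(I,j), each a copy of the field or of an algebra of finite-row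
    matrices, and a lower layer absorbs a higher one. Indeed, for [i <= j] an element of the layer
    at [j], cut down to the indices whose chain contains [i], is again the image under [psi] of a
    matrix over {i <=} ([psi_le_factor]), while layers at incomparable elements annihilate each
    other, no chain containing both ([psi_incomparable_mul]). Moreover, finitely many elements of
    one layer lie in a common copy of some full matrix algebra ([H_at_locally_full_matrix]).

    What remains is an extension problem, settled by [locally_units_ideal]: if an ideal [T] is
    locally a full matrix algebra and a subalgebra [H] is locally spanned by blocks of matrix units,
    then so is [T + H]. The units [e] of [H] are made independent of [T] by an idempotent [g] of [T]
    that commutes with them and fixes the given elements of [T] ([commuting_local_unit]): the units
    [(1 - g) * e l m] are orthogonal to the corner of [g], and that corner holds everything else.
    Regularity of [T] produces [g].

    Finite index sets follow by removing a minimal element ([H_sum_seq_locally_units]); arbitrary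
    ones reduce to them, since finitely many elements involve finitely many layers. Finally
    [matricial_of_units] turns units into a matricial algebra. *)

Section MatrixUnits.
Variables (K : fieldType) (A : algType K).
Implicit Types (S T H : set A) (N : nat) (s : seq A).

(** * Linear combinations of matrix units, regularity and local identities *)

Lemma subalgebra_sum S (J : Type) (r : seq J) (P : pred J) (F : J -> A) :
  subalgebra S -> (forall j, P j -> S (F j)) -> S (\sum_(j <- r | P j) F j).
Proof. by move=> [S0 SD _ _] SF; apply: big_ind. Qed.

Lemma subalgebraN S a : subalgebra S -> S a -> S (- a).
Proof. by move=> [_ _ SZ _] Sa; rewrite -scaleN1r; exact: SZ. Qed.

Definition mx_comb N (E : 'I_N -> 'I_N -> A) (M : 'M[K]_N) : A :=
  \sum_a \sum_b M a b *: E a b.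

Section MxComb.
Variables (N : nat) (E : 'I_N -> 'I_N -> A).
Local Notation phi := (mx_comb E).

Fact mx_comb_is_linear : linear phi.
Proof.
move=> c M M'; rewrite /mx_comb scaler_sumr -big_split; apply: eq_bigr => a _.
rewrite scaler_sumr -big_split; apply: eq_bigr => b _ /=.
by rewrite !mxE scalerDl scalerA.
Qed.

HB.instance Definition _ :=
  GRing.isLinear.Build K 'M[K]_N A _ phi mx_comb_is_linear.

Lemma mx_comb_in S M : subalgebra S -> (forall a b, S (E a b)) -> S (phi M).
Proof.
move=> SA SE; apply: subalgebra_sum => // a _; apply: subalgebra_sum => // b _.
by case: SA => _ _ SZ _; exact: SZ.
Qed.

Hypothesis unitE : forall a b c d, E a b * E c d = E a d *+ (b == c).

Lemma mx_combM M M' : phi M * phi M' = phi (M *m M').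
Proof.
rewrite /mx_comb mulr_suml; apply: eq_bigr => a _.
under [RHS]eq_bigr => d _ do rewrite mxE scaler_suml.
rewrite [RHS]exchange_big mulr_suml; apply: eq_bigr => b _ /=.
rewrite mulr_sumr (bigD1 b) //= [X in _ + X]big1 ?addr0 => [|c cb].
  rewrite mulr_sumr; apply: eq_bigr => d _.
  by rewrite -scalerAl -scalerAr unitE eqxx scalerA.
rewrite mulr_sumr big1 // => d _.
by rewrite -scalerAl -scalerAr unitE eq_sym (negPf cb) !scaler0.
Qed.

Lemma mx_comb_delta a b : phi (delta_mx a b) = E a b.
Proof.
rewrite /mx_comb (bigD1 a) //= (bigD1 b) //= mxE !eqxx scale1r.
rewrite big1 => [|c cb]; last by rewrite mxE (negPf cb) andbF scale0r.
rewrite addr0 big1 ?addr0 // => c ca; rewrite big1 // => e _.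
by rewrite mxE (negPf ca) scale0r.
Qed.

(** Coefficients can be read off: [E a a * phi M * E b a] equals [M a b *: E a a]. *)
Lemma mx_comb_inj : (forall a, E a a != 0) -> injective phi.
Proof.
move=> E0; apply: raddf_inj => M phiM; apply/matrixP => a b; rewrite [RHS]mxE.
have := congr1 (fun x => E a a * x * E b a) phiM.
rewrite mulr0 mul0r -!mx_comb_delta !mx_combM.
have -> : delta_mx a a *m M *m delta_mx b a = M a b *: delta_mx a a.
  apply/matrixP => i j; rewrite !mxE (bigD1 b) //= big1 => [|k kb].
    rewrite !mxE (bigD1 a) //= big1 => [|l la].
      by rewrite !mxE !eqxx andbT addr0 addr0 -mulrA mulrCA -natrM mulnb.
    by rewrite !mxE (negPf la) andbF mul0r.
  by rewrite [delta_mx _ _ _ _]mxE (negPf kb) mulr0.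
move/eqP; rewrite linearZ /= mx_comb_delta scaler_eq0 (negPf (E0 a)) orbF.
by move/eqP.
Qed.

End MxComb.

Definition locally_full_matrix T : Prop :=
  forall s, (forall x, x \in s -> T x) ->
  exists N (E : 'I_N -> 'I_N -> A),
    [/\ forall a b, T (E a b),
        forall a, E a a != 0,
        forall a b c d, E a b * E c d = E a d *+ (b == c) &
        forall x, x \in s -> exists M, x = mx_comb E M].

(** Regularity is inherited from full matrix algebras, where [pinvmx M] is a quasi-inverse of
    [M]. *)
Lemma locally_full_matrix_regular T : subalgebra T -> locally_full_matrix T ->
  forall t, T t -> exists2 u, T u & t * u * t = t.
Proof.
move=> TA TE t Tt; have [|N [E [ET E0 unitE inE]]] := TE [:: t].
  by move=> x; rewrite inE => /eqP->.
have [M ->] := inE t (mem_head _ _); exists (mx_comb E (pinvmx M)).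
  exact: mx_comb_in.
by rewrite !mx_combM // mulmxKpV.
Qed.

(* The idempotent is enlarged one element at a time: if [t' := t - g * t] and *)
(* [u] is a quasi-inverse of [t'], then [h := t' * u * (1 - g) * p] is an     *)
(* idempotent orthogonal to [g] and [g + h] fixes [t]; dually on the right.   *)
Lemma corner_local_units T p (L R : seq A) : subalgebra T ->
  (forall t, T t -> exists2 u, T u & t * u * t = t) ->
  p * p = p -> (forall t, T t -> T (p * t) /\ T (t * p)) ->
  (forall t, t \in L -> T t /\ p * t = t) ->
  (forall t, t \in R -> T t /\ t * p = t) ->
  exists g, [/\ T g, g * g = g, p * g = g /\ g * p = g,
                forall t, t \in L -> g * t = t &
                forall t, t \in R -> t * g = t].
Proof.
move=> TA reg pp pT LT RT; have [T0 TD TZ TM] := TA.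
have TN := subalgebraN TA.
have TB a b : T a -> T b -> T (a - b) by move=> Ta Tb; apply: TD => //; exact: TN.
(* The base case in [L] is the whole induction on [R]. Passing from [g] to [g + h] spoils nothing:
   [h] is orthogonal to [g] on both sides, so [h * x = h * (g * x) = 0] when [g] already fixes [x]
   on the left, and dually on the right. *)
elim: L LT => [_|t L IH LT].
  elim: R RT => [_|t R IH RT].
    by exists 0; rewrite ?mulr0 ?mul0r.
  have [|g [Tg gg [pg gp] Lg Rg]] := IH.
    by move=> u uR; apply: RT; rewrite inE uR orbT.
  have [Tt tp] := RT t (mem_head _ _).
  pose t' := t - t * g.
  have Tt' : T t' by apply: TB => //; exact: TM.
  have t'p : t' * p = t' by rewrite mulrBl -mulrA gp tp.
  have t'g : t' * g = 0 by rewrite mulrBl -mulrA gg subrr.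
  have [u Tu t'ut'] := reg _ Tt'.
  pose v := p * u - g * (p * u).
  have Tv : T v by have [Tpu _] := pT _ Tu; apply: TB => //; exact: TM.
  have gv : g * v = 0 by rewrite mulrBr !mulrA gg subrr.
  have t'v : t' * v = t' * u by rewrite mulrBr !mulrA t'g t'p !mul0r subr0.
  pose h := v * t'.
  have Th : T h by exact: TM.
  have hh : h * h = h.
    by rewrite /h mulrA -[v * t' * v]mulrA t'v -!mulrA [t' * (u * t')]mulrA t'ut'.
  have gh : g * h = 0 by rewrite mulrA gv mul0r.
  have hg : h * g = 0 by rewrite -mulrA t'g mulr0.
  have pv : p * v = v by rewrite /v mulrBr !mulrA pp pg.
  exists (g + h); split.
  - exact: TD.
  - by rewrite mulrDl !mulrDr gg gh hg hh addr0 add0r.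
  - by rewrite mulrDl mulrDr pg gp /h mulrA pv -[v * t' * p]mulrA t'p.
  - by [].
  - move=> x; rewrite inE => /predU1P[->|xR].
      have th : t * h = t' + t * g * h.
        by rewrite -{1}[t](subrK (t * g)) mulrDl /h [t' * _]mulrA t'v t'ut'.
      by rewrite mulrDr th -mulrA gh mulr0 addr0 addrC subrK.
    by rewrite mulrDr -{2}(Rg x xR) -mulrA gh mulr0 addr0 Rg.
have [|g [Tg gg [pg gp] Lg Rg]] := IH.
  by move=> u uR; apply: LT; rewrite inE uR orbT.
have [Tt pt] := LT t (mem_head _ _).
pose t' := t - g * t.
have Tt' : T t' by apply: TB => //; exact: TM.
have pt' : p * t' = t' by rewrite mulrBr mulrA pg pt.
have gt' : g * t' = 0 by rewrite mulrBr mulrA gg subrr.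
have [u Tu t'ut'] := reg _ Tt'.
pose v := u * p - u * p * g.
have Tv : T v by have [_ Tpu] := pT _ Tu; apply: TB => //; exact: TM.
have vg : v * g = 0 by rewrite mulrBl -!mulrA gg subrr.
have vt' : v * t' = u * t' by rewrite mulrBl -!mulrA gt' pt' !mulr0 subr0.
pose h := t' * v.
have Th : T h by exact: TM.
have hh : h * h = h by rewrite /h -mulrA [v * (t' * v)]mulrA vt' !mulrA t'ut'.
have hg : h * g = 0 by rewrite -mulrA vg mulr0.
have gh : g * h = 0 by rewrite mulrA gt' mul0r.
have vp : v * p = v by rewrite /v mulrBl -!mulrA pp gp.
exists (g + h); split.
- exact: TD.
- by rewrite mulrDl !mulrDr gg gh hg hh addr0 add0r.
- by rewrite mulrDl mulrDr pg gp /h mulrA pt' -mulrA vp.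
- move=> x; rewrite inE => /predU1P[->|xL].
    have ht : h * t = t' + h * (g * t).
      by rewrite -{1}[t](subrK (g * t)) mulrDr /h -[t' * v * t']mulrA vt' mulrA t'ut'.
    by rewrite mulrDl ht mulrA hg mul0r addr0 addrC subrK.
  by rewrite mulrDl -{2}(Lg x xL) mulrA hg mul0r addr0 Lg.
- by move=> x xR; rewrite mulrDr -{2}(Rg x xR) -mulrA gh mulr0 addr0 Rg.
Qed.

(** * Systems of matrix units arranged in blocks *)

Section Blocks.
Variables (L B : finType) (blk : L -> B) (e : L -> L -> A).

(* Only the [e l m] with [blk l = blk m] are meaningful; they may vanish. *)
Definition matrix_units : Prop :=
  forall l m l' m', blk l = blk m -> blk l' = blk m' ->
    e l m * e l' m' = e l m' *+ (m == l').

(** Quantifying over subalgebras makes a change of units easy: it is enough that the new units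
    generate the old ones. *)
Definition unit_generated (x : A) : Prop :=
  forall S, subalgebra S -> (forall l m, blk l = blk m -> S (e l m)) -> S x.

End Blocks.

(** Allowing zero units keeps the induction simple, as [(1 - g) * e l m] may vanish; they are
    discarded only in [matricial_of_units]. *)
Definition locally_units H : Prop :=
  forall s, (forall x, x \in s -> H x) ->
  exists (L B : finType) (blk : L -> B) (e : L -> L -> A),
    [/\ matrix_units blk e,
        forall l m, blk l = blk m -> H (e l m) &
        forall x, x \in s -> unit_generated blk e x].

(** * Local identities of an ideal that commute with given matrix units *)

Section CommutingUnit.
Variables (L B : finType) (blk : L -> B) (e : L -> L -> A) (T : set A).
Hypothesis eU : matrix_units blk e.
Hypothesis TA : subalgebra T.
Hypothesis regT : forall t, T t -> exists2 u, T u & t * u * t = t.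
Hypothesis eT : forall l m t, blk l = blk m -> T t ->
  T (e l m * t) /\ T (t * e l m).

(** In each block an idempotent is chosen in the corner of one diagonal unit and copied to the other
    labels by conjugation with the units, which makes the sum [g1] commute with them. A further
    idempotent [g0], annihilated by all units, takes care of the corner of [1 - o]. *)
Lemma commuting_local_unit (F : seq A) : (forall t, t \in F -> T t) ->
  exists g, [/\ T g, g * g = g,
    forall l m, blk l = blk m -> e l m * g = g * e l m &
    forall t, t \in F -> g * t = t /\ t * g = t].
Proof.
move=> FT; have [T0 TD TZ TM] := TA.
pose rep l := odflt l [pick m | blk m == blk l].
have blk_rep l : blk (rep l) = blk l.
  by rewrite /rep; case: pickP => [m /eqP //|/(_ l)]; rewrite eqxx.
have rep_eq l m : blk l = blk m -> rep l = rep m.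
  move=> lm; rewrite /rep lm; case: pickP => // /(_ m).
  by rewrite eqxx.
(* All [e l m * t] with [m] in the block of [l] must be fixed, since conjugation brings every row of
   [t] in that block to the representative; dually for columns. *)
have unit_corner l : exists g, [/\ T g, e l l * g = g /\ g * e l l = g,
    g * g = g,
    forall t m, t \in F -> blk l = blk m -> g * (e l m * t) = e l m * t &
    forall t m, t \in F -> blk l = blk m -> t * e m l * g = t * e m l].
  have [||||g [Tg gg lg Lg Rg]] := @corner_local_units T (e l l)
      [seq e l m * t | m <- enum [pred m | blk l == blk m], t <- F]
      [seq t * e m l | m <- enum [pred m | blk l == blk m], t <- F] TA regT.
  - by rewrite eU // eqxx.
  - by move=> t; exact: eT.
  - move=> x /allpairsP[[m t] /= [+ /FT Tt ->]].
    rewrite mem_enum inE => /eqP lm; split; first by have [] := eT lm Tt.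
    by rewrite mulrA eU // eqxx.
  - move=> x /allpairsP[[m t] /= [+ /FT Tt ->]].
    rewrite mem_enum inE => /eqP lm; split.
      by have [] := eT (esym lm) Tt.
    by rewrite -mulrA eU // eqxx.
  exists g; split=> // t m tF lm; [apply: Lg|apply: Rg].
    by apply/allpairsP; exists (m, t); rewrite mem_enum inE lm.
  by apply/allpairsP; exists (m, t); rewrite mem_enum inE lm.
have [gam gamP] := choice unit_corner.
(* [o] is an identity for the units. It need not lie in [T], but multiplication by [o] and by
   [1 - o] preserves [T]. *)
pose o := \sum_l e l l.
have oe l m : blk l = blk m -> o * e l m = e l m.
  move=> lm; rewrite mulr_suml (bigD1 l) //= eU // eqxx big1 ?addr0 // => k kl.
  by rewrite eU // (negPf kl).
have eo l m : blk l = blk m -> e l m * o = e l m.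
  move=> lm; rewrite mulr_sumr (bigD1 m) //= eU // eqxx big1 ?addr0 // => k km.
  by rewrite eU // eq_sym (negPf km).
have oo : o * o = o by rewrite {2}/o mulr_sumr; apply: eq_bigr => l _; exact: oe.
have oT t : T t -> T (o * t) /\ T (t * o).
  move=> Tt; rewrite mulr_suml mulr_sumr.
  by split; apply: subalgebra_sum => // l _; have [] := @eT l l t erefl Tt.
have p1 : (1 - o) * (1 - o) = 1 - o.
  by rewrite mulrBl mul1r mulrBr mulr1 oo subrr subr0.
have TN := subalgebraN TA.
have pT t : T t -> T ((1 - o) * t) /\ T (t * (1 - o)).
  move=> Tt; have [To1 To2] := oT _ Tt.
  by rewrite mulrBl mulrBr mul1r mulr1; split; apply: TD => //; exact: TN.
have [||g0 [Tg0 gg0 [pg0 g0p] Lg0 Rg0]] := @corner_local_units T (1 - o)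
    [seq (1 - o) * t | t <- F] [seq t * (1 - o) | t <- F] TA regT p1 pT.
- by move=> x /mapP[t /FT Tt ->]; split; [have [] := pT _ Tt|rewrite mulrA p1].
- by move=> x /mapP[t /FT Tt ->]; split; [have [] := pT _ Tt|rewrite -mulrA p1].
have og0 : o * g0 = 0.
  by move/eqP: pg0; rewrite mulrBl mul1r subr_eq addrC -subr_eq subrr eq_sym => /eqP.
have g0o : g0 * o = 0.
  by move/eqP: g0p; rewrite mulrBr mulr1 subr_eq addrC -subr_eq subrr eq_sym => /eqP.
have eg0 l m : blk l = blk m -> e l m * g0 = 0.
  by move=> lm; rewrite -(eo _ _ lm) -mulrA og0 mulr0.
have g0e l m : blk l = blk m -> g0 * e l m = 0.
  by move=> lm; rewrite -(oe _ _ lm) mulrA g0o mul0r.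
pose g1 := \sum_l e l (rep l) * gam (rep l) * e (rep l) l.
have eg1 l m : blk l = blk m ->
    e l m * g1 = e l (rep l) * gam (rep l) * e (rep l) m.
  move=> lm; rewrite mulr_sumr (bigD1 m) //= big1 => [|k km]; last first.
    by rewrite !mulrA eU ?blk_rep // eq_sym (negPf km) !mul0r.
  by rewrite !mulrA eU ?blk_rep // eqxx (rep_eq _ _ lm) addr0.
have g1e l m : blk l = blk m ->
    g1 * e l m = e l (rep l) * gam (rep l) * e (rep l) m.
  move=> lm; rewrite mulr_suml (bigD1 l) //= big1 => [|k km]; last first.
    by rewrite -!mulrA eU ?blk_rep // (negPf km) !mulr0.
  by rewrite -!mulrA eU ?blk_rep // eqxx addr0.
have Tg1 : T g1.
  apply: subalgebra_sum => // l _; have [Tg _ _ _ _] := gamP (rep l).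
  have [Tl _] := eT (esym (blk_rep l)) Tg.
  by have [_] := eT (blk_rep l) Tl.
have og1 : o * g1 = g1.
  by rewrite mulr_sumr; apply: eq_bigr => l _; rewrite !mulrA oe ?blk_rep.
have g1o : g1 * o = g1.
  by rewrite mulr_suml; apply: eq_bigr => l _; rewrite -!mulrA eo ?blk_rep.
have g01 : g0 * g1 = 0 by rewrite -og1 mulrA g0o mul0r.
have g10 : g1 * g0 = 0 by rewrite -g1o -mulrA og0 mulr0.
have g11 : g1 * g1 = g1.
  rewrite {1}/g1 mulr_suml; apply: eq_bigr => l _.
  have [_ [eg ge] gg _ _] := gamP (rep l).
  rewrite -mulrA eg1 ?blk_rep // (rep_eq _ _ (blk_rep l)).
  by rewrite !mulrA -[_ * _ * e _ (rep l)]mulrA ge -[_ * _ * gam _]mulrA gg.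
exists (g0 + g1); split.
- exact: TD.
- by rewrite mulrDl !mulrDr gg0 g01 g10 g11 addr0 add0r.
- by move=> l m lm; rewrite mulrDl mulrDr eg0 // g0e // eg1 // g1e.
move=> t tF; split.
  have -> : (g0 + g1) * t = (1 - o) * t + o * t.
    rewrite mulrDl -[in LHS]g0p -mulrA Lg0; last exact: map_f.
    congr (_ + _); rewrite /g1 /o !mulr_suml; apply: eq_bigr => l _.
    have [_ _ _ gl _] := gamP (rep l).
    by rewrite -!mulrA gl ?blk_rep // mulrA eU ?blk_rep // eqxx.
  by rewrite -mulrDl subrK mul1r.
have -> : t * (g0 + g1) = t * (1 - o) + t * o.
  rewrite mulrDr -[in LHS]pg0 mulrA Rg0; last exact: map_f.
  congr (_ + _); rewrite /g1 /o !mulr_sumr; apply: eq_bigr => l _.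
  have [_ _ _ _ gr] := gamP (rep l).
  by rewrite !mulrA gr ?blk_rep // -mulrA eU ?blk_rep // eqxx.
by rewrite -mulrDr subrK mulr1.
Qed.

End CommutingUnit.

End MatrixUnits.

(** * Extension of matrix units across an ideal *)

Section LocallyUnits.
Variables (K : fieldType) (A : algType K).
Implicit Types (S T H : set A) (s : seq A).

(** With [G = C *m R] the rank factorization, cancelling the full-rank outer factors in
    [C *m R *m C *m R = C *m R] leaves [R *m C = 1]. *)
Lemma idempotent_mx_split N (G : 'M[K]_N) : G *m G = G ->
  exists r (C : 'M_(N, r)) (R : 'M_(r, N)), C *m R = G /\ R *m C = 1%:M.
Proof.
move=> GG; have CR := mulmx_base G.
exists (\rank G), (col_base G), (row_base G); split=> //.
apply: (row_full_inj (col_base_full G)); apply: (row_free_inj (row_base_free G)).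
rewrite mulmx1 mulmxA -mulmxA.
by change (col_base G *m row_base G *m (col_base G *m row_base G) =
           col_base G *m row_base G); rewrite CR.
Qed.

(* If [g] is an idempotent of the ideal [T] acting as an identity on the      *)
(* given elements of [T] and commuting with the units [e l m] chosen in [H],  *)
(* then the corner [g T g] contributes one full matrix block and the          *)
(* [(1 - g) * e l m] contribute the remaining ones.                           *)
Lemma locally_units_ideal T H : subalgebra T -> subalgebra H ->
  (forall t h, T t -> H h -> T (t * h) /\ T (h * t)) ->
  locally_full_matrix T -> locally_units H ->
  locally_units [set x | exists t h, [/\ T t, H h & x = t + h]].
Proof.
move=> TA HA TH fullT unitsH s sP; have [T0 TD TZ TM] := TA.
have TN := subalgebraN TA.
have [tc tcP] : exists tc : A -> A, forall x, x \in s -> T (tc x) /\ H (x - tc x).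
  suff /choice[tc tcP] : forall x, exists t, x \in s -> T t /\ H (x - t) by exists tc.
  move=> x; have [/sP[t [h [Tt Hh ->]]]|_] := boolP (x \in s); last by exists 0.
  by exists t; rewrite addrC addKr.
have [|L [B [blk [e [eU eH eGen]]]]] := unitsH [seq x - tc x | x <- s].
  by move=> y /mapP[x /tcP[_ Hx] ->].
have eT l m t : blk l = blk m -> T t -> T (e l m * t) /\ T (t * e l m).
  by move=> /eH He Tt; have [] := TH _ _ Tt He.
have regT := locally_full_matrix_regular TA fullT.
have [|g [Tg gg ge gF]] := commuting_local_unit eU TA regT eT (F := map tc s).
  by move=> y /mapP[x /tcP[Tx _] ->].
(* These elements of [T] must also be captured, because [e l m] is to be recovered as
   [(1 - g) * e l m + g * e l m]. *)
pose ges := [seq g * e l m | l <- enum L, m <- enum [pred m | blk l == blk m]].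
have gesP l m : blk l = blk m -> g * e l m \in ges.
  by move=> lm; apply/allpairsPdep; exists l, m; rewrite !mem_enum !inE lm eqxx.
have [|N [E [ET E0 unitE memE]]] := fullT (g :: map tc s ++ ges).
  move=> y; rewrite inE mem_cat => /orP[/eqP->//|/orP[/mapP[x /tcP[Tx _] ->]//|]].
  move=> /allpairsPdep[l [m [_ + ->]]].
  by rewrite mem_enum inE => /eqP lm; have [] := eT l m g lm Tg; rewrite ge.
pose phi := mx_comb E.
have phiM := mx_combM unitE; have phiI := mx_comb_inj unitE E0.
have [G gE] := memE g (mem_head _ _).
have GG : G *m G = G by apply: phiI; rewrite -phiM -gE.
have [r [C [R [CR RC]]]] := idempotent_mx_split GG.
(* As [R *m C = 1], these are matrix units of size the rank of [G]; they span the corner of [g],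
   since [G *m M *m G = C *m (R *m M *m C) *m R]. *)
pose E' a b := phi (C *m delta_mx a b *m R).
have E'E a b c d : E' a b * E' c d = E' a d *+ (b == c).
  rewrite /E' /phi phiM -raddfMn /= !mulmxA -[_ *m R *m C]mulmxA RC mulmx1.
  rewrite -[C *m _ *m _]mulmxA mul_delta_mx_cond.
  by case: (b == c); rewrite ?mulr1n // !mulr0n mulmx0 mul0mx.
have gE' a b : g * E' a b = E' a b /\ E' a b * g = E' a b.
  rewrite gE /E' /phi !phiM !mulmxA -CR -!mulmxA.
  by rewrite ![R *m (C *m _)]mulmxA RC !mul1mx.
have corner_in S x : subalgebra S -> (forall a b, S (E' a b)) ->
    (exists M, x = phi M) -> g * x = x -> x * g = x -> S x.
  move=> SA SE' [M ->] gx xg; have GM : G *m M *m G = M.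
    by apply: phiI; rewrite -!phiM -gE [g * _]gx [_ * g]xg.
  rewrite -GM -CR -(mulmxA (C *m R)) mulmxA -!(mulmxA C) !mulmxA -(mulmxA C).
  rewrite -(mulmxA C) [R *m M *m C]matrix_sum_delta mulmx_sumr mulmx_suml.
  rewrite /phi linear_sum; apply: subalgebra_sum => // a _ /=.
  rewrite mulmx_sumr mulmx_suml linear_sum; apply: subalgebra_sum => // b _ /=.
  rewrite -scalemxAr -scalemxAl linearZ /=.
  by have [_ _ SZ _] := SA; apply: SZ; exact: SE'.
(* The corner of [g] is the new block [None]; old blocks keep their names under [Some]. *)
pose blk' (x : 'I_r + L) := if x is inr l then Some (blk l) else None.
pose e' (x y : 'I_r + L) := match x, y with
  | inl a, inl b => E' a b
  | inr l, inr m => (1 - g) * e l m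
  | _, _ => 0
  end.
have H0 : H 0 by case: HA.
have E'T a b : T (E' a b) by exact: mx_comb_in.
exists ('I_r + L)%type, (option B), blk', e'; split.
- move=> [a|l] [b|m] [c|l'] [d|m']  //= => [_ [lm]|[lm] _|[lm] [lm']].
  + by rewrite mulrA mulrBr mulr1 (gE' a b).2 subrr mul0r mulr0n.
  + rewrite -(gE' c d).1 mulrA -[_ * e l m * g]mulrA ge // !mulrA mulrBl mul1r.
    by rewrite gg subrr !mul0r mulr0n.
  + have cm : e l m * (1 - g) = (1 - g) * e l m.
      by rewrite mulrBr mulr1 ge // mulrBl mul1r.
    have g1 : (1 - g) * (1 - g) = 1 - g.
      by rewrite mulrBr mulr1 mulrBl mul1r gg subrr subr0.
    rewrite (inj_eq inr_inj) mulrA -[_ * e l m * _]mulrA cm mulrA g1.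
    by rewrite -mulrA eU // mulrnAr.
- move=> [a|l] [b|m] //= => [_|[lm]].
    by exists (E' a b), 0; rewrite addr0.
  exists (- (g * e l m)), (e l m); split; first by apply: TN; case: (eT l m g lm Tg).
    exact: eH.
  by rewrite mulrBl mul1r addrC.
move=> x xs S SA Se'; have [S0 SD SZ SM] := SA.
have SE' a b : S (E' a b) by exact: (Se' (inl a) (inl b)).
rewrite -[x](subrK (tc x)) addrC; apply: (SD).
  have [gx xg] := gF (tc x) (map_f tc xs).
  by apply: corner_in => //; apply: memE; rewrite inE mem_cat map_f ?orbT.
apply: eGen => //; first by apply/mapP; exists x.
move=> l m lm; rewrite -[e l m](subrK (g * e l m)); apply: SD.
  by have := Se' (inr l) (inr m); rewrite /= mulrBl mul1r lm; apply.
apply: corner_in => //.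
- by apply: memE; rewrite inE mem_cat gesP ?orbT.
- by rewrite mulrA gg.
- by rewrite -mulrA ge // mulrA gg.
Qed.

(** * From matrix units to a product of full matrix algebras *)

Section MatricialOfUnits.
Variables (L B : finType) (blk : L -> B) (e : L -> L -> A).
Hypothesis eU : matrix_units blk e.

(** Only labels with nonzero diagonal unit are kept, and only blocks containing such a label, so
    that every size [n k] is positive. *)
Let Lnz := [set l | e l l != 0]%SET.
Let Bnz := (blk @: Lnz)%SET.
Let cls (k : 'I_#|Bnz|) := [set l in Lnz | blk l == enum_val k]%SET.
Let n (k : 'I_#|Bnz|) := #|cls k|.
Let lab (k : 'I_#|Bnz|) (a : 'I_(n k)) : L := enum_val a.
Let F (M : forall k, 'M[K]_(n k)) : A :=
  \sum_k mx_comb (fun a b => e (lab a) (lab b)) (M k).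

Let labP k (a : 'I_(n k)) : e (lab a) (lab a) != 0 /\ blk (lab a) = enum_val k.
Proof.
by have := enum_valP a; rewrite !inE => /andP[? /eqP].
Qed.

Let lab_unit k (a b c d : 'I_(n k)) : e (lab a) (lab b) * e (lab c) (lab d) =
  e (lab a) (lab d) *+ (b == c).
Proof.
by rewrite eU ?(labP _).2 // (inj_eq enum_val_inj).
Qed.

Let lab_unit0 k k' (a b : 'I_(n k)) (c d : 'I_(n k')) : k != k' ->
  e (lab a) (lab b) * e (lab c) (lab d) = 0.
Proof.
move=> kk'; rewrite eU ?(labP _).2 //; case: eqP => // bc; case/eqP: kk'.
by apply: enum_val_inj; rewrite -(labP b).2 -(labP c).2 bc.
Qed.

Let FM M M' : F (fun k => M k *m M' k) = F M * F M'.
Proof.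
rewrite mulr_suml; apply: eq_bigr => k _.
rewrite mulr_sumr (bigD1 k) //= mx_combM; last exact: lab_unit.
rewrite big1 ?addr0 // => k' k'k; rewrite mulr_suml big1 // => a _.
rewrite mulr_suml big1 // => b _; rewrite mulr_sumr big1 // => c _.
rewrite mulr_sumr big1 // => d _.
by rewrite -scalerAl -scalerAr lab_unit0 ?scaler0 // eq_sym.
Qed.

Let FD M M' : F (fun k => M k + M' k) = F M + F M'.
Proof. by rewrite -big_split; apply: eq_bigr => k _; rewrite linearD. Qed.

Let FZ c M : F (fun k => c *: M k) = c *: F M.
Proof. by rewrite scaler_sumr; apply: eq_bigr => k _; rewrite linearZ. Qed.

Let F_inj M M' : F M = F M' -> M = M'.
Proof.
move=> MM'; apply: functional_extensionality_dep => k.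
apply: (@mx_comb_inj _ _ _ (fun a b : 'I_(n k) => e (lab a) (lab b))).
- exact: lab_unit.
- by move=> a; have [] := labP a.
(* [M1] is the identity of block [k]; multiplying by it isolates the [k]-th summand of [F]. *)
pose M1 k' : 'M[K]_(n k') := (k' == k)%:R%:M.
have FM1 M2 : F (fun k' => M1 k' *m M2 k') =
    mx_comb (fun a b => e (lab a) (lab b)) (M2 k).
  rewrite /F (bigD1 k) //= /M1 eqxx mul1mx big1 ?addr0 // => k' /negPf->.
  by rewrite mul_scalar_mx scale0r linear0.
by rewrite -!FM1 !FM MM'.
Qed.

Lemma matricial_of_units : exists S, [/\ matricial S,
  (forall x, unit_generated blk e x -> S x) &
  forall S', subalgebra S' -> (forall l m, blk l = blk m -> S' (e l m)) ->
    S `<=` S'].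
Proof.
have RA : subalgebra (range F).
  split.
  - by exists (fun=> 0) => //; rewrite /F big1 // => k _; rewrite linear0.
  - by move=> _ _ [M _ <-] [M' _ <-]; exists (fun k => M k + M' k); rewrite ?FD.
  - by move=> c _ [M _ <-]; exists (fun k => c *: M k); rewrite ?FZ.
  - by move=> _ _ [M _ <-] [M' _ <-]; exists (fun k => M k *m M' k); rewrite ?FM.
exists (range F); split.
- split=> //; exists #|Bnz|, n, F; split=> //.
    move=> k; have /imsetP[l lnz kl] := enum_valP k.
    by rewrite card_gt0; apply/set0Pn; exists l; rewrite inE lnz kl eqxx.
  split=> [M _|M M' _ _|//]; first by exists M.
  exact: F_inj.
- move=> x; apply=> // l m lm.
  (* A zero diagonal unit kills its row, as [e l m = e l l * e l m]; a nonzero one forces all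
     diagonal units of its block to be nonzero. *)
  have [l0|lnz] := eqVneq (e l l) 0.
    suff -> : e l m = 0 by case: RA.
    by rewrite -[RHS](mul0r (e l m)) -l0 eU // eqxx.
  have mnz : e m m != 0.
    apply: contra_neq lnz => m0.
    have -> : e l l = e l m * e m l by rewrite eU // eqxx.
    have -> : e l m = e l m * e m m by rewrite eU // eqxx.
    by rewrite m0 mulr0 mul0r.
  have bB : blk l \in Bnz by apply: imset_f; rewrite inE.
  pose k := enum_rank_in bB (blk l).
  have kE : enum_val k = blk l by rewrite enum_rankK_in.
  have lc : l \in cls k by rewrite !inE lnz kE eqxx.
  have mc : m \in cls k by rewrite !inE mnz kE lm eqxx.
  pose a : 'I_(n k) := enum_rank_in lc l; pose b : 'I_(n k) := enum_rank_in lc m.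
  have aE : lab a = l by rewrite /lab enum_rankK_in.
  have bE : lab b = m by rewrite /lab enum_rankK_in.
  exists (fun k' => if k' =P k is ReflectT kk then
    castmx (f_equal n (esym kk), f_equal n (esym kk)) (delta_mx a b) else 0) => //.
  rewrite /F (bigD1 k) //= big1 => [|k' k'k].
    case: eqP => // kk; rewrite (Prop_irrelevance kk erefl) castmx_id addr0.
    by rewrite mx_comb_delta aE bE.
  by case: eqP => [kk|_]; [rewrite kk eqxx in k'k|rewrite linear0].
move=> S' SA' Se _ [M _ <-]; apply: subalgebra_sum => // k _.
by apply: mx_comb_in => // a b; apply: Se; rewrite !(labP _).2.
Qed.

End MatricialOfUnits.

Lemma locally_units_matricial R :
  subalgebra R -> locally_units R -> @locally_matricial K A R.
Proof.
move=> RA unitsR; split=> // F finF FR; have [s sE] := (finite_seqP _).1 finF.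
have [|L [B [blk [e [eU eR gen]]]]] := unitsR s.
  by move=> x xs; apply: FR; rewrite sE.
have [S [matS SF SR]] := matricial_of_units eU.
exists S; split=> //; last exact: SR.
by move=> x; rewrite sE => /gen; exact: SF.
Qed.

End LocallyUnits.

(** * Matrices with finitely many nonzero rows *)

Lemma finite_spanning_family (K : fieldType) (V : vectType K) (Y : Type)
    (w : Y -> V) : exists C : seq Y, forall y, (w y \in <<map w C>>)%VS.
Proof.
pose P n := `[< exists C, \dim <<map w C>>%VS = n >].
have exP : exists n, P n by exists (\dim <<map w [::]>>%VS); apply/asboolP; exists [::].
have boundP n : P n -> (n <= \dim {:V})%N.
  by move=> /asboolP[C <-]; apply: dimvS; exact: subvf.
(* [C] has a span of largest possible dimension, which no further vector can enlarge. *)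
have [_ /asboolP[C <-] maxC] := ex_maxnP exP boundP.
exists C => y; have sub : (<<map w C>> <= <<map w (y :: C)>>)%VS.
  by rewrite /= span_cons; exact: addvSr.
have /eqP-> : <<map w C>>%VS == <<map w (y :: C)>>%VS.
  by rewrite eqEdim sub; apply: maxC; apply/asboolP; exists (y :: C).
by apply: memv_span; exact: mem_head.
Qed.

Section FiniteRows.
Variables (Y : pointedType) (K : fieldType).
Implicit Types (a b t : cfm Y K) (x y z : Y).

Lemma cfm_sumE (J : Type) (r : seq J) (P : pred J) (F : J -> cfm Y K) x y :
  (\sum_(j <- r | P j) F j) x y = \sum_(j <- r | P j) F j x y.
Proof. exact: (big_morph (fun a : cfm Y K => a x y)). Qed.

Lemma finite_rows_subalgebra : subalgebra (@finite_rows Y K).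
Proof.
split=> [|a b Fa Fb|c a Fa|a b Fa Fb].
- by apply: (sub_finite_set (B := set0)) => // x [y] /=; rewrite eqxx.
- apply: sub_finite_set (_ : finite_set (_ `|` _)); last first.
    by rewrite finite_setU; split; [exact: Fa|exact: Fb].
  move=> x [y]; rewrite cfm_addE /=.
  have [->|ax _] := eqVneq (a x y) 0; last by left; exists y.
  by rewrite add0r => bx; right; exists y.
- apply: sub_finite_set Fa => x [y]; rewrite cfm_scaleE mulf_eq0 negb_or.
  by move=> /andP[_ ax]; exists y.
- apply: sub_finite_set Fa => x [z] abx /=; apply: contrapT => na.
  case/eqP: abx; have [B hB] := cfm_col_fset b z.
  rewrite cfm_mulE -/(cfm_mul_fun a b x z) (cfm_mul_funE _ _ hB) big1 // => y _.
  have [->|axy] := eqVneq (a x y) 0; first by rewrite mul0r.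
  by case: na; exists y.
Qed.

Lemma finite_rows_mulr a c : finite_rows a -> finite_rows (a * c).
Proof.
move=> Fa; apply: sub_finite_set Fa => x [z] abx /=; apply: contrapT => na.
case/eqP: abx; have [B hB] := cfm_col_fset c z.
rewrite cfm_mulE -/(cfm_mul_fun a c x z) (cfm_mul_funE _ _ hB) big1 // => y _.
have [->|axy] := eqVneq (a x y) 0; first by rewrite mul0r.
by case: na; exists y.
Qed.

(** The nonzero rows of [a] select finitely many columns of [c], each with finite support. *)
Lemma finite_rows_mull a c : finite_rows a -> finite_rows (c * a).
Proof.
move=> /finite_fsetP[B FB]; have [C hC] := cfm_cols_fset c B.
apply: (finite_subfset C) => x [z] /=; apply: contraNT => xC.
have [D hD] := cfm_col_fset a z.
rewrite (cfm_mul_funE _ _ hD) big1 // => y _.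
have [->|ayz] := eqVneq (a y z) 0; first by rewrite mulr0.
have yB : y \in B by have : [set` B] y by rewrite -FB; exists z.
have -> : c x y = 0 by apply: contraNeq xC; exact: hC.
by rewrite mul0r.
Qed.

(* The columns of the given matrices, restricted to the finitely many nonzero *)
(* rows, span a finite-dimensional space: so there is a finite set [D] such   *)
(* that every [t] among them is [t x y = \sum_(d in D) t x d * Z d y].        *)
Lemma finite_rows_locally_full_matrix : locally_full_matrix (@finite_rows Y K).
Proof.
move=> s sF.
have [B hB] : exists B : {fset Y}, forall t x y, t \in s -> t x y != 0 -> x \in B.
  elim: s sF => [|t s IH] sF; first by exists fset0.
  have [|B hB] := IH; first by move=> u us; apply: sF; rewrite inE us orbT.
  have /finite_fsetP[C hC] := sF t (mem_head _ _).
  exists (B `|` C)%fset => u x y; rewrite !inE => /predU1P[->|us] uxy.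
    by have -> : x \in C; [have : [set` C] x by rewrite -hC; exists y|rewrite orbT].
  by rewrite (hB u x y).
pose w y := [ffun p : B * 'I_(size s) => cfm_val (nth 0 s p.2) (val p.1) y : K^o].
have [C hC] := finite_spanning_family w.
pose D := undup (B ++ C); pose N := size D.
pose dn (i : 'I_N) := nth point D i.
have dn_inj i j : (dn i == dn j) = (i == j) by rewrite nth_uniq ?undup_uniq.
pose W := map_tuple w (in_tuple D).
have wW y : (w y \in <<W>>)%VS.
  apply: subvP (hC y); apply: sub_span => _ /mapP[z zC ->].
  by apply: map_f; rewrite mem_undup mem_cat zC orbT.
(* The columns indexed by [D] may be linearly dependent, so on [D] Kronecker deltas replace the
   coordinates. [E a b] below has the single nonzero row [dn a], equal to [Z b], and [Zdn] gives the
   unit relations. *)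
pose Z (i : 'I_N) y : K := if y \in D then (y == dn i)%:R else coord W i (w y).
have Zdn i j : Z i (dn j) = (j == i)%:R by rewrite /Z mem_nth // dn_inj.
have tZ t x y : t \in s -> t x y = \sum_i t x (dn i) * Z i y.
  move=> ts; have [xB|xB] := boolP (x \in B); last first.
    have t0 z : t x z = 0 by apply: contraNeq xB; exact: hB.
    by rewrite t0 big1 // => i _; rewrite t0 mul0r.
  rewrite /Z; have [yD|yD] := boolP (y \in D).
    have iN : (index y D < N)%N by rewrite index_mem.
    rewrite (bigD1 (Ordinal iN)) //= big1 => [|i].
      by rewrite /dn /= nth_index // eqxx mulr1 addr0.
    rewrite -dn_inj eq_sym /dn /= nth_index // => /negPf->.
    by rewrite mulr0.
  have si : (index t s < size s)%N by rewrite index_mem.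
  have := congr1 (fun f : {ffun _} => f ([` xB]%fset, Ordinal si)) (coord_span (wW y)).
  rewrite sum_ffunE !ffunE /= nth_index // => ->; apply: eq_bigr => i _.
  rewrite !ffunE /= (nth_map point) // ffunE /= nth_index //.
  by rewrite mulrC.
have Efin (a b : 'I_N) : (fun x y => (x == dn a)%:R * Z b y) \in @col_finite Y K.
  apply/asboolP => y; apply: (finite_subfset [fset dn a]%fset) => x /=.
  by rewrite inE; case: (_ =P dn _) => // _; rewrite mul0r eqxx.
pose E (a b : 'I_N) : cfm Y K := CFM (Efin a b).
exists N, E; split.
- move=> a b; apply: (finite_subfset [fset dn a]%fset) => x [y] /=.
  by rewrite inE; case: (_ =P dn _) => // _; rewrite mul0r eqxx.
- move=> a; apply/eqP => /cfm_eqP/(_ (dn a) (dn a))/eqP /=.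
  by rewrite Zdn !eqxx mulr1 oner_eq0.
- move=> a b c d; apply/cfm_eqP => x z.
  rewrite cfm_mulE -/(cfm_mul_fun (E a b) (E c d) x z).
  rewrite (@cfm_mul_funE _ _ _ _ _ _ [fset dn c]%fset) => [|y /=]; last first.
    by rewrite inE; case: (_ =P dn _) => // _; rewrite mul0r eqxx.
  rewrite big_seq_fset1 /= Zdn eqxx mul1r [c == b]eq_sym.
  by case: (b == c); rewrite ?mulr1 ?mulr0 ?mul0r.
move=> t ts; exists (\matrix_(a, b) t (dn a) (dn b)); apply/cfm_eqP => x y.
rewrite cfm_sumE; have [xD|xD] := boolP (x \in D).
  have iN : (index x D < N)%N by rewrite index_mem.
  have xE : x = dn (Ordinal iN) by rewrite /dn /= nth_index.
  rewrite (bigD1 (Ordinal iN)) //= [X in _ + X]big1 => [|a an]; last first.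
    rewrite cfm_sumE big1 // => b _; rewrite cfm_scaleE /= {1}xE dn_inj eq_sym.
    by rewrite (negPf an) mul0r mulr0.
  rewrite addr0 cfm_sumE (tZ t) //; apply: eq_bigr => b _.
  by rewrite cfm_scaleE /= mxE -xE eqxx mul1r.
rewrite big1 => [|a _]; last first.
  rewrite cfm_sumE big1 // => b _; rewrite cfm_scaleE /=.
  case: eqP => [xa|_]; last by rewrite mul0r mulr0.
  by rewrite xa mem_nth in xD.
apply: contraNeq xD => /(hB _ _ _ ts) xB.
by rewrite mem_undup mem_cat xB.
Qed.

End FiniteRows.

(** * Maximal chains through a given element *)

Section MaximalChainsThrough.
Variables (d : Order.disp_t) (P : porderType d).
Implicit Types (i k : P) (A : set P).

Definition comparable_to i : Type := {k : P | (k >=< i)%O}.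
HB.instance Definition _ i := SubChoice.on (comparable_to i).
HB.instance Definition _ i :=
  [SubChoice_isSubPOrder of comparable_to i by <: with d].

(** A maximal chain among the elements comparable to [i] contains [i], and any chain of [P]
    containing [i] consists of such elements. *)
Lemma max_chain_through i : exists2 A, max_chains P A & A i.
Proof.
have [C [totC maxC]] := max_chains_neq0 (comparable_to i).
have totA : total_on (val @` C) (<=%O : rel P).
  by move=> _ _ [u Cu <-] [v Cv <-]; exact: totC.
pose i' : comparable_to i := exist _ i (comparablexx i).
have Ci : C i'.
  have <- : C `|` [set i'] = C; last by right.
  apply: maxC; last by left.
  have cmp (u : comparable_to i) : (u <= i')%O \/ (i' <= u)%O.
    by apply/orP; exact: (valP u).
  move=> u v [Cu|->] [Cv|->]; [exact: totC|exact: cmp| |by left].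
  by case: (cmp v); [right|left].
exists (val @` C); last by exists i'.
split=> // B totB AB; apply/seteqP; split=> // k Bk.
have ki : (k >=< i)%O.
  by apply/orP; apply: totB => //; apply: AB; exists i'.
exists (exist _ k ki : comparable_to i) => //.
rewrite -(maxC [set u : comparable_to i | B (val u)]) //.
  by move=> u v; exact: totB.
by move=> u Cu; apply: AB; exists u.
Qed.

(** For a larger chain [B], its part below [i] is controlled by maximality of [A], after adjoining
    the upper part of [A], and its part above [i] by maximality of [C]. *)
Lemma glue_max_chain i A (C : set (up i)) :
  max_chains P A -> A i -> max_chains (up i) C ->
  max_chains P
    [set k | (A k /\ (k <= i)%O) \/ exists ik : (i <= k)%O, C (exist _ k ik)].
Proof.
move=> [totA maxA] Ai [totC maxC]; set D := [set k | _].
split=> [k l [[Ak ki]|[ik Ck]] [[Al li]|[il Cl]]|B totB DB].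
- exact: totA.
- by left; exact: le_trans ki il.
- by right; exact: le_trans li ik.
- exact: (totC _ _ Ck Cl).
apply/seteqP; split=> // k Bk.
have Bi : B i by apply: DB; left.
have [ki|ik] := totB _ _ Bk Bi.
  left; split=> //.
  rewrite -(maxA ([set l | B l /\ (l <= i)%O] `|` [set l | A l /\ (i <= l)%O])).
  - by left.
  - move=> l m [[Bl li]|[Al il]] [[Bm mi]|[Am im]].
    + exact: totB.
    + by left; exact: le_trans li im.
    + by right; exact: le_trans mi il.
    + exact: totA.
  - move=> l Al; have [li|il] := totA _ _ Al Ai; last by right.
    by left; split=> //; apply: DB; left.
right; exists ik; rewrite -(maxC [set u : up i | B (val u)]) //.
  by move=> u v; exact: totB.
by move=> [l il] Cl; apply: DB; right; exists il.
Qed.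

End MaximalChainsThrough.

(** * The embeddings [psi] and their products *)

Section Psi.
Variables (da : Order.disp_t) (aleph : bOrderType da) (K : fieldType).
Variables (d : Order.disp_t) (I : porderType d).
Implicit Types (i j k : I) (x y z : Xidx aleph I).

Local Notation psi := (@psi da aleph K d I _).
Local Notation cfm_up i := (cfm (Xidx aleph (up i)) K).

Lemma Xidx_ext (P : porderType d) (x y : Xidx aleph P) :
  idx_map x = idx_map y -> idx_chain x = idx_chain y -> x = y.
Proof.
by case: x y => [p A] [q B] pq AB; congr pair; apply: val_inj.
Qed.

Lemma idx_chain_total x k l : idx_chain x k -> idx_chain x l ->
  (k <= l)%O \/ (l <= k)%O.
Proof. exact: (set_valP x.2).1. Qed.

Lemma restr_eqP i x y (ix : idx_chain x i) (iy : idx_chain y i) :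
  restr ix = restr iy <->
  (forall k, (i <= k)%O -> idx_map x k = idx_map y k) /\
  (forall k, (i <= k)%O -> idx_chain x k = idx_chain y k).
Proof.
split=> [E|[mE cE]].
  split=> k ik.
    exact: (congr1 (fun u => idx_map u (exist _ k ik : up i)) E).
  exact: (congr1 (fun u => idx_chain u (exist _ k ik : up i)) E).
apply: Xidx_ext; apply/funext => k; first exact: mE (valP k).
exact: cE (valP k).
Qed.

Lemma compatible_sym i x y : compatible i x y -> compatible i y x.
Proof. by move=> [c m]; split=> [|k /m]. Qed.

Lemma compatible_trans i x y z :
  compatible i x y -> compatible i y z -> compatible i x z.
Proof. by move=> [c m] [c' m']; split=> [|k ik]; [rewrite c|rewrite m ?m']. Qed.

Lemma compatible_chain i x y k : compatible i x y -> (k <= i)%O ->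
  idx_chain x k -> idx_chain y k.
Proof.
move=> [c _] ki xk.
by have [] : [set k | idx_chain y k /\ (k <= i)%O] k by rewrite -c.
Qed.

Lemma compatible_le i j x y : (i <= j)%O -> compatible j x y -> compatible i x y.
Proof.
move=> ij xy; have yx := compatible_sym xy; split=> [|k ik].
  apply/seteqP; split=> k [ck ki]; split=> //.
    by apply: (compatible_chain xy) => //; exact: le_trans ki ij.
  by apply: (compatible_chain yx) => //; exact: le_trans ki ij.
by case: xy => _; apply; apply: contra ik; exact: le_trans.
Qed.

Lemma psiE i (a : cfm_up i) x y (ix : idx_chain x i) (iy : idx_chain y i) :
  compatible i x y -> psi a x y = a (restr ix) (restr iy).
Proof.
move=> xy; rewrite /= /psi_fun; case: pselect => // ix'; case: pselect => // iy'.
case: pselect => // _.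
by rewrite (Prop_irrelevance ix' ix) (Prop_irrelevance iy' iy).
Qed.

Lemma psi_neq0 i (a : cfm_up i) x y : psi a x y != 0 ->
  [/\ idx_chain x i, idx_chain y i & compatible i x y].
Proof.
rewrite /= /psi_fun; case: pselect => // [ix|?]; last by rewrite eqxx.
case: pselect => // [iy|?]; last by rewrite eqxx.
by case: pselect => // ?; rewrite eqxx.
Qed.

Lemma psi_is_linear i : linear (@Defs.psi da aleph K d I i).
Proof.
move=> c a b; apply/cfm_eqP => x y; rewrite cfm_addE cfm_scaleE.
rewrite /= /psi_fun; case: pselect => ?; last by rewrite mulr0 addr0.
case: pselect => ?; last by rewrite mulr0 addr0.
by case: pselect => ? //; rewrite mulr0 addr0.
Qed.

HB.instance Definition _ i := GRing.isLinear.Build K (cfm_up i)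
  (Qalg aleph K I) _ (@Defs.psi da aleph K d I i) (@psi_is_linear i).

(** Together with [restr_inj], restriction is a bijection from each compatibility class through [i]
    onto the index set of {i <=}; [psi] repeats a matrix along all these classes. *)
Lemma restr_surj i x : idx_chain x i ->
  exists h : Xidx aleph (up i) -> Xidx aleph I,
    forall u, compatible i (h u) x /\ exists iu, @restr _ _ _ _ i (h u) iu = u.
Proof.
move=> ix; suff : forall u : Xidx aleph (up i), exists y, compatible i y x /\
    exists iy, @restr _ _ _ _ i y iy = u by move=> E; have [h hP] := choice E; exists h.
move=> [q C]; pose p k : aleph :=
  if pselect (i <= k)%O is left ik then val q (exist _ k ik) else idx_map x k.
have pT k (ik : (i <= k)%O) : p k = val q (exist _ k ik).
  by rewrite /p; case: pselect => // ik'; rewrite (Prop_irrelevance ik' ik).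
have pF k : ~~ (i <= k)%O -> p k = idx_map x k.
  by move=> /negP ik; rewrite /p; case: pselect.
have fp : Defs.finsupp aleph I p.
  have fx : finite_set [set k | idx_map x k != \bot%O] by exact: set_valP x.1.
  have fq : finite_set [set k | val q k != \bot%O] by exact: set_valP q.
  apply: (@sub_finite_set _ _ ([set k | idx_map x k != \bot%O] `|`
      (fun k : up i => val k) @` [set k | val q k != \bot%O])); last first.
    by rewrite finite_setU; split=> //; exact: finite_image.
  move=> k /=; have [ik|ik] := boolP (i <= k)%O.
    by rewrite (pT _ ik) => qk; right; exists (exist _ k ik).
  by rewrite pF // => xk; left.
have gA := glue_max_chain (set_valP x.2) ix (set_valP C).
pose y : Xidx aleph I := (SigSub (mem_set fp), SigSub (mem_set gA)).
have iC k (ik : (i <= k)%O) :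
    idx_chain y k = val C (exist _ k ik : up i).
  apply/propext; split=> [[[xk ki]|[ik' Ck]]|Ck]; last by right; exists ik.
    have ki' : k = i by apply/eqP; rewrite eq_le ki ik.
    (* A maximal chain of {i <=} contains its least element, so the two glued parts agree at [i]. *)
    have [totC maxC] := set_valP C.
    pose k' : up i := exist _ k ik; have k'le (u : up i) : (k' <= u)%O.
      by rewrite leEsub /= ki'; exact: valP u.
    rewrite -(maxC (val C `|` [set k'])); first by right.
      move=> u v [Cu|->] [Cv|->]; [exact: totC|right|left|left]; exact: k'le.
    by left.
  by rewrite (Prop_irrelevance ik ik').
have iy : idx_chain y i by left; split; [exact: ix|exact: lexx].
exists y; split.
  split=> [|k /pF //]; apply/seteqP; split=> k [yk ki]; split=> //.
    case: yk => [[]//|[ik _]].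
    by have -> : k = i by apply/eqP; rewrite eq_le ki ik.
  by left.
exists iy; apply: Xidx_ext; apply/funext => -[k ik]; first exact: pT.
exact: iC.
Qed.

Lemma psiM i (a b : cfm_up i) : psi (a * b) = psi a * psi b.
Proof.
apply/cfm_eqP => x z; apply/esym; rewrite cfm_mulE.
have [[ix iz xz]|nxz] := pselect [/\ idx_chain x i, idx_chain z i & compatible i x z];
    last first.
  rewrite fsbig1 => [|y _].
    by apply/esym/eqP; apply: contra_notT nxz; exact: psi_neq0.
  apply/eqP; apply: contra_notT nxz; rewrite mulf_eq0 negb_or.
  move=> /andP[/psi_neq0[ix iy xy] /psi_neq0[_ iz yz]].
  by split=> //; exact: compatible_trans xy yz.
rewrite (psiE _ ix iz xz) cfm_mulE; have [h hP] := restr_surj ix.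
have h_inj : injective h.
  move=> u v uv; have [_ [iu <-]] := hP u; have [_ [iv <-]] := hP v.
  by apply/restr_eqP; rewrite uv.
(* A nonzero term forces [y] to be compatible with [x], hence to be [h] of its restriction. *)
rewrite -(@fsbig_widen _ _ _ _ (range h)) //; last first.
  move=> y [_ ny]; apply/eqP; apply: contra_notT ny; rewrite mulf_eq0 negb_or.
  move=> /andP[/psi_neq0[_ iy xy] _]; exists (restr iy) => //.
  have [hx [iu hu]] := hP (restr iy).
  by apply: restr_inj hu; exact: compatible_trans hx xy.
rewrite (reindex_fsbig h setT); last first.
  by split=> [u _|u v _ _|//]; [exists u|exact: h_inj].
apply: eq_fsbigr => u _; have [hx [iu uE]] := hP u; rewrite -[in RHS]uE.
congr (_ * _); apply: psiE; last exact: compatible_trans hx xz.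
exact: compatible_sym.
Qed.

Lemma psi_inj i : injective (@Defs.psi da aleph K d I i).
Proof.
move=> a b ab; have [A maxA Ai] := max_chain_through i.
pose x : Xidx aleph I := (SigSub (mem_set (cst_bot_finsupp aleph I)),
                          SigSub (mem_set maxA)).
have ix : idx_chain x i by [].
have [h hP] := restr_surj ix; apply/cfm_eqP => u v.
have [hu [iu uE]] := hP u; have [hv [iv vE]] := hP v.
rewrite -uE -vE -!psiE ?ab //; apply: compatible_trans hu _;
  exact: compatible_sym.
Qed.

Lemma psi1E i x y : psi (1 : cfm_up i) x y = (x == y)%:R *+ `[< idx_chain x i >].
Proof.
case: asboolP => [ix|nix]; last first.
  by apply/eqP; apply: contra_notT nix => /psi_neq0[].
have [<-|xy] := eqVneq x y; first by rewrite (psiE _ ix ix) // cfm_oneE eqxx.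
apply/eqP; apply: contraNT xy => p0; have [_ iy xy] := psi_neq0 p0.
move: p0; rewrite (psiE _ ix iy xy) cfm_oneE.
by case: (restr ix =P _) => [E _|]; [rewrite (restr_inj xy E)|]; rewrite eqxx.
Qed.

Lemma mul_psi1 i (q : Qalg aleph K I) x z :
  (q * psi (1 : cfm_up i)) x z = q x z *+ `[< idx_chain z i >].
Proof.
rewrite cfm_mulE (fsbigTE [fset z]%fset) => [|y].
  by rewrite big_seq_fset1 psi1E eqxx mulrnAr mulr1.
by rewrite inE psi1E => /negPf->; rewrite mul0rn mulr0.
Qed.

Lemma psi1_mul i (q : Qalg aleph K I) x z :
  (psi (1 : cfm_up i) * q) x z = q x z *+ `[< idx_chain x i >].
Proof.
rewrite cfm_mulE (fsbigTE [fset x]%fset) => [|y].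
  by rewrite big_seq_fset1 psi1E eqxx mulrnAl mul1r.
by rewrite inE psi1E eq_sym => /negPf->; rewrite mul0rn mul0r.
Qed.

(** Compatibility at [i] settles what happens below [i] and off {i <=}; the rest of compatibility at
    [j], and the entry itself, depend on the restrictions alone. *)
Lemma psi_restr_invariant i j (b : cfm_up j) x y x' y'
    (ix : idx_chain x i) (iy : idx_chain y i)
    (ix' : idx_chain x' i) (iy' : idx_chain y' i) :
  (i <= j)%O -> compatible i x y -> compatible i x' y' ->
  restr ix = restr ix' -> restr iy = restr iy' -> psi b x y = psi b x' y'.
Proof.
move=> ij; wlog nz : x y x' y' ix iy ix' iy' / psi b x y != 0.
  move=> IH xy xy' xx' yy'; have [p0|nz] := eqVneq (psi b x y) 0.
    have [p0'|nz] := eqVneq (psi b x' y') 0; first by rewrite p0.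
    exact/esym/(IH _ _ _ _ ix' iy' ix iy nz).
  exact: (IH _ _ _ _ ix iy ix' iy' nz).
move=> xy xy' /restr_eqP[mx cx] /restr_eqP[my cy].
have [jx jy cxy] := psi_neq0 nz.
have jx' : idx_chain x' j by rewrite -cx.
have jy' : idx_chain y' j by rewrite -cy.
have cxy' : compatible j x' y'.
  split=> [|k jk]; last first.
    have [ik|/(proj2 xy') //] := boolP (i <= k)%O.
    by rewrite -mx // -my //; case: cxy => _; apply.
  apply/seteqP; split=> k [ck kj]; split=> //.
    have [ki|ik] := idx_chain_total ck ix'; first exact: (compatible_chain xy').
    by rewrite -cy //; apply: (compatible_chain cxy) => //; rewrite cx.
  have [ki|ik] := idx_chain_total ck iy'.
    exact: (compatible_chain (compatible_sym xy')).
  by rewrite -cx //; apply: (compatible_chain (compatible_sym cxy)) => //; rewrite cy.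
rewrite (psiE _ jx jy cxy) (psiE _ jx' jy' cxy').
by congr (b _ _); apply/restr_eqP; split=> k jk; [apply: mx|apply: cx|apply: my|
  apply: cy]; exact: le_trans ij jk.
Qed.

(* [psi c] is the block of [psi b] on the indices whose chain contains [i].   *)
Lemma psi_le_factor i j (b : cfm_up j) : (i <= j)%O ->
  exists c : cfm_up i, psi b * psi (1 : cfm_up i) = psi c /\
                       psi (1 : cfm_up i) * psi b = psi c.
Proof.
move=> ij; have [A maxA Ai] := max_chain_through i.
pose x0 : Xidx aleph I := (SigSub (mem_set (cst_bot_finsupp aleph I)),
                           SigSub (mem_set maxA)).
have ix0 : idx_chain x0 i by [].
have [h hP] := restr_surj ix0.
have cfin : (fun u v => psi b (h u) (h v)) \in @col_finite (Xidx aleph (up i)) K.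
  apply/asboolP => v.
  apply: (finite_preimage (f := h) _ (cfm_col_finite (psi b) (h v))).
  move=> u u' _ _ uu'; have [_ [iu <-]] := hP u; have [_ [iu' <-]] := hP u'.
  by apply/restr_eqP; rewrite uu'.
(* [c] reads [psi b] on the class of [x0]; by [psi_restr_invariant] every class gives the same
   entries. *)
pose c : cfm_up i := CFM cfin; exists c.
have cE x y (ix : idx_chain x i) (iy : idx_chain y i) : psi b x y = psi c x y.
  have [xy|nxy] := pselect (compatible i x y); last first.
    have -> : psi b x y = 0.
      apply/eqP; apply: contra_notT nxy => /psi_neq0[_ _].
      exact: compatible_le.
    by apply/esym/eqP; apply: contra_notT nxy => /psi_neq0[].
  rewrite (psiE c ix iy xy).
  change (psi b x y = psi b (h (restr ix)) (h (restr iy))).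
  have [hx [iu uE]] := hP (restr ix); have [hy [iv vE]] := hP (restr iy).
  apply: (psi_restr_invariant b ij xy _ (esym uE) (esym vE)).
  by apply: compatible_trans hx _; exact: compatible_sym.
have bi x y : psi b x y != 0 -> idx_chain x i <-> idx_chain y i.
  move=> /psi_neq0[_ _ xy]; split; apply: compatible_chain ij => //.
  exact: compatible_sym.
have c0 x y : ~ (idx_chain x i /\ idx_chain y i) -> psi c x y = 0.
  by move=> n; apply/eqP; apply: contra_notT n => /psi_neq0[].
have bc x y : psi b x y *+ `[< idx_chain y i >] = psi c x y.
  case: asboolP => [iy|niy]; last by rewrite c0 // => -[].
  have [ix|nix] := pselect (idx_chain x i); first exact: cE.
  rewrite c0 => [|[] //]; apply/eqP; apply: contra_notT nix => /bi[_].
  exact.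
have bxy x y : psi b x y *+ `[< idx_chain x i >] = psi b x y *+ `[< idx_chain y i >].
  have [->|/bi xy] := eqVneq (psi b x y) 0; first by rewrite !mul0rn.
  by congr (_ *+ nat_of_bool _); exact: asbool_equiv_eq.
by split; apply/cfm_eqP => x y; rewrite ?mul_psi1 ?psi1_mul ?bxy bc.
Qed.

End Psi.

Lemma seq_minimal (d : Order.disp_t) (P : porderType d) (s : seq P) : s != [::] ->
  exists2 j, j \in s & forall k, k \in s -> (k <= j)%O -> k = j.
Proof.
elim: s => // a [_ _|b s IH _].
  by exists a; rewrite ?mem_head // => k; rewrite inE => /eqP.
have [//|m ms minm] := IH; have [am|nam] := boolP (a <= m)%O.
  exists a; rewrite ?mem_head // => k; rewrite inE => /predU1P[//|ks] ka.
  have km := minm _ ks (le_trans ka am); rewrite km in ka *.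
  by apply/eqP; rewrite eq_le ka am.
exists m; first by rewrite inE ms orbT.
move=> k; rewrite inE => /predU1P[->|]; last exact: minm.
by rewrite (negPf nam).
Qed.

(** * The layers H(I,i) and their sums H(I,J) *)

Section HSum.
Variables (da : Order.disp_t) (aleph : bOrderType da) (K : fieldType).
Variables (d : Order.disp_t) (I : porderType d).
Implicit Types (i j k : I) (J : set I).

Local Notation Q := (Qalg aleph K I).
Local Notation cfm_up i := (cfm (Xidx aleph (up i)) K).
Local Notation H_at := (H_at aleph K).
Local Notation H_sum := (H_sum aleph K).
Local Notation maximal := (wochoice.maximal (<=%O : rel I)).

Lemma H_at_psi i (b : Q) : H_at i b -> exists a : cfm_up i, b = psi a.
Proof.
by case=> -[_ [c E]]; [exists (c *: 1); rewrite linearZ|exists c].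
Qed.

Lemma H_at_subalgebra i : subalgebra (H_at i).
Proof.
have [maxi|nmax] := pselect (maximal i).
  have HE b : H_at i b <-> exists c : K, b = c *: psi (1 : cfm_up i).
    by split=> [[[_]//|[]//]|?]; left.
  split.
  - by apply/HE; exists 0; rewrite scale0r.
  - by move=> _ _ /HE[c ->] /HE[c' ->]; apply/HE; exists (c + c'); rewrite scalerDl.
  - by move=> c _ /HE[c' ->]; apply/HE; exists (c * c'); rewrite scalerA.
  - move=> _ _ /HE[c ->] /HE[c' ->]; apply/HE; exists (c * c').
    by rewrite -scalerAl -scalerAr -psiM mulr1 scalerA.
have HE b : H_at i b <-> exists2 a : cfm_up i, finite_rows a & b = psi a.
  by split=> [[[]//|[_]//]|?]; right.
have [F0 FD FZ FM] := finite_rows_subalgebra (Xidx aleph (up i)) K.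
split.
- by apply/HE; exists 0; rewrite ?linear0.
- by move=> _ _ /HE[a Fa ->] /HE[b Fb ->]; apply/HE; exists (a + b);
     rewrite ?linearD //; exact: FD.
- by move=> c _ /HE[a Fa ->]; apply/HE; exists (c *: a);
     rewrite ?linearZ //; exact: FZ.
- by move=> _ _ /HE[a Fa ->] /HE[b Fb ->]; apply/HE; exists (a * b);
     rewrite ?psiM //; exact: FM.
Qed.

Lemma psi_incomparable_mul i j (a : cfm_up i) (b : cfm_up j) :
  ~~ (i >=< j)%O -> psi a * psi b = 0 :> Q.
Proof.
move=> nij; apply/cfm_eqP => x z; rewrite cfm_mulE fsbig1 // => y _.
apply/eqP; apply: contraNT nij; rewrite mulf_eq0 negb_or.
move=> /andP[/psi_neq0[_ iy _] /psi_neq0[jy _ _]].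
by apply/orP; exact: idx_chain_total iy jy.
Qed.

(** Incomparable layers multiply to zero. If [i < j], then [i] is not maximal, so H(I,i) comes from
    the two-sided ideal of finite-row matrices, and [psi_le_factor] moves the other factor over {i
    <=}. *)
Lemma H_at_mul i j (t h : Q) : ~~ (j <= i)%O -> H_at i t -> H_at j h ->
  H_at i (t * h) /\ H_at i (h * t).
Proof.
move=> nji Ht /H_at_psi[b ->]; have [ij|nij] := boolP (i <= j)%O; last first.
  have [H0 _ _ _] := H_at_subalgebra i.
  have nc : ~~ (i >=< j)%O by rewrite /Order.comparable negb_or nij.
  have [a ->] := H_at_psi Ht.
  rewrite !psi_incomparable_mul //; first by rewrite comparable_sym.
case: Ht => [[maxi _]|[nmax [a Fa ->]]].
  by have := maxi j ij; rewrite (negPf nji).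
have [c [bc cb]] := psi_le_factor b ij.
split; right; split=> //.
  exists (a * c); first exact: finite_rows_mulr.
  by rewrite psiM -cb mulrA -psiM mulr1.
exists (c * a); first exact: finite_rows_mull.
by rewrite psiM -bc -mulrA -psiM mul1r.
Qed.

Lemma H_at_locally_full_matrix i : locally_full_matrix (H_at i).
Proof.
have [maxi|nmax] := pselect (maximal i).
  move=> s sH; exists 1%N, (fun _ _ => psi (1 : cfm_up i)); split.
  - by move=> _ _; left; split=> //; exists 1; rewrite scale1r.
  - move=> _; rewrite -(linear0 (@Defs.psi da aleph K d I i)) (inj_eq (@psi_inj _ _ _ _ _ _)).
    exact: oner_neq0.
  - by move=> a b c e; rewrite !ord1 -psiM mulr1.
  - move=> x /sH[[_ [c ->]]|[]//]; exists (const_mx c).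
    by rewrite /mx_comb !big_ord1 mxE.
move=> s sH; have HE b : H_at i b -> exists2 a : cfm_up i, finite_rows a & b = psi a.
  by case=> [[]//|[_]].
have [r rP] : exists r : Q -> cfm_up i,
    forall x, x \in s -> finite_rows (r x) /\ x = psi (r x).
  suff E : forall x, exists a : cfm_up i, x \in s -> finite_rows a /\ x = psi a.
    by have [r rP] := choice E; exists r.
  move=> x; have [/sH/HE[a Fa xa]|_] := boolP (x \in s); last by exists 0.
  by exists a.
have [|N [E [EF E0 EM Es]]] :=
  @finite_rows_locally_full_matrix (Xidx aleph (up i)) K (map r s).
  by move=> _ /mapP[x /rP[Fx _] ->].
exists N, (fun a b => psi (E a b)); split.
- by move=> a b; right; split=> //; exists (E a b).
- by move=> a; rewrite -(linear0 (@Defs.psi da aleph K d I i)) (inj_eq (@psi_inj _ _ _ _ _ _)).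
- by move=> a b c e; rewrite -psiM EM linearMn.
move=> x xs; have [_ xE] := rP _ xs; have [M rM] := Es _ (map_f r xs).
exists M; rewrite xE rM linear_sum; apply: eq_bigr => a _.
by rewrite linear_sum; apply: eq_bigr => b _; rewrite linearZ.
Qed.

Lemma H_sum_at J j (b : Q) : J j -> H_at j b -> H_sum J b.
Proof.
move=> Jj Hb; exists [:: j], (fun=> b); split=> //; last by rewrite big_seq1.
by move=> k; rewrite inE => /eqP->.
Qed.

Lemma H_sum0 J : H_sum J 0.
Proof. by exists [::], (fun=> 0); split=> //; rewrite big_nil. Qed.

Lemma H_sumD J (a b : Q) : H_sum J a -> H_sum J b -> H_sum J (a + b).
Proof.
move=> [s [h [us sP ->]]] [s' [h' [us' sP' ->]]].
pose ext (r : seq I) (f : I -> Q) j := if j \in r then f j else 0.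
exists (undup (s ++ s')), (fun j => ext s h j + ext s' h' j); split.
- exact: undup_uniq.
- move=> j; rewrite mem_undup mem_cat => jss'; split.
    by case/orP: jss' => [/sP[]|/sP'[]].
  have [H0 HD _ _] := H_at_subalgebra j; rewrite /ext; apply: HD.
    by case: ifP => // /sP[].
  by case: ifP => // /sP'[].
have extE r (f : I -> Q) : uniq r -> {subset r <= s ++ s'} ->
    \sum_(j <- r) f j = \sum_(j <- undup (s ++ s')) ext r f j.
  move=> ur sub; rewrite /ext -big_mkcond -big_filter; apply: perm_big.
  apply: uniq_perm => // [|j]; first by rewrite filter_uniq // undup_uniq.
  rewrite mem_filter mem_undup; have [/sub->|//] := boolP (j \in r).
  by [].
rewrite big_split; congr (_ + _); apply: extE => // j js; rewrite mem_cat js //.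
by rewrite orbT.
Qed.

Lemma H_sum_ind J (S : set Q) : S 0 -> (forall a b, S a -> S b -> S (a + b)) ->
  (forall j b, J j -> H_at j b -> S b) -> H_sum J `<=` S.
Proof.
move=> S0 SD SH _ [s [h [_ sP ->]]]; rewrite big_seq; apply: big_ind => // j.
by move=> /sP[Jj]; exact: SH.
Qed.

Lemma sub_H_sum J J' : J `<=` J' -> H_sum J `<=` H_sum J'.
Proof.
move=> JJ'; apply: H_sum_ind; [exact: H_sum0|exact: H_sumD|].
by move=> j b /JJ'; exact: H_sum_at.
Qed.

Lemma H_sum_subalgebra J : subalgebra (H_sum J).
Proof.
split; [exact: H_sum0|exact: H_sumD| |].
  move=> c; apply: (@H_sum_ind J [set a | H_sum J (c *: a)]) => [/=|a b /=|j a Jj Ha /=].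
  - by rewrite scaler0; exact: H_sum0.
  - by rewrite scalerDr; exact: H_sumD.
  - by apply: (H_sum_at Jj); have [_ _ HZ _] := H_at_subalgebra j; exact: HZ.
move=> a b aH; move: b; apply: (@H_sum_ind J [set b | H_sum J (a * b)])
    => [/=|b b' /=|j b Jj Hb /=].
- by rewrite mulr0; exact: H_sum0.
- by rewrite mulrDr; exact: H_sumD.
move: a aH; apply: (@H_sum_ind J [set a | H_sum J (a * b)])
    => [/=|a a' /=|i a Ji Ha /=].
- by rewrite mul0r; exact: H_sum0.
- by rewrite mulrDl; exact: H_sumD.
have [ji|nji] := boolP (j <= i)%O; last first.
  by apply: (H_sum_at Ji); have [] := H_at_mul nji Ha Hb.
have [ij|nij] := boolP (i <= j)%O; last first.
  by apply: (H_sum_at Jj); have [] := H_at_mul nij Hb Ha.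
have ji' : j = i by apply/eqP; rewrite eq_le ij ji.
rewrite ji' in Hb; apply: (H_sum_at Ji).
by have [_ _ _ HM] := H_at_subalgebra i; exact: HM.
Qed.

Lemma H_sum_mul_minimal J i (t h : Q) : (forall j, J j -> ~~ (j <= i)%O) ->
  H_at i t -> H_sum J h -> H_at i (t * h) /\ H_at i (h * t).
Proof.
move=> nJ Ht; have [H0 HD _ _] := H_at_subalgebra i.
apply: (@H_sum_ind J [set h | H_at i (t * h) /\ H_at i (h * t)])
    => [/=|a b /= [ta at'] [tb bt]|j b /nJ nji Hb] /=.
- by rewrite mulr0 mul0r.
- by rewrite mulrDr mulrDl; split; exact: HD.
- exact: (H_at_mul nji).
Qed.

Lemma H_sum_seq_locally_units (s : seq I) : locally_units (H_sum [set` s]).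
Proof.
have [n] := ubnP (size s); elim: n s => // n IH s sn.
have [-> r rH|s0] := eqVneq s [::].
  exists void, unit, (fun=> tt), (fun _ _ => 0); split=> [[]|[]|x /rH xH S [S0 _ _ _] _].
  suff -> : x = 0 by [].
  by apply: (@H_sum_ind [set` [::]] [set 0]) xH => // a b -> ->; rewrite addr0.
have [j js minj] := seq_minimal s0.
(* Every occurrence of [j] is removed, so by minimality nothing left is below [j] and H(I,j) absorbs
   the remaining sum. *)
pose s' := [seq k <- s | k != j].
have s's : (size s' < n)%N.
  rewrite size_filter; apply: leq_trans (_ : (size s <= n)%N) => //.
  by rewrite -(count_predC (pred1 j)) -[X in (X < _)%N]add0n ltn_add2r -has_count has_pred1.
have nj k : [set` s'] k -> ~~ (k <= j)%O.
  rewrite /= mem_filter => /andP[kj ks]; apply: contra kj => kj.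
  exact/eqP/minj.
have -> : H_sum [set` s] =
    [set x | exists t h, [/\ H_at j t, H_sum [set` s'] h & x = t + h]].
  apply/seteqP; split.
    have [H0 HD _ _] := H_at_subalgebra j.
    apply: H_sum_ind => [|a b|k b /= ks Hb].
    - by exists 0, 0; split=> //; [exact: H_sum0|rewrite addr0].
    - move=> [t [h [Ht Hh ->]]] [t' [h' [Ht' Hh' ->]]].
      exists (t + t'), (h + h'); rewrite addrACA; split=> //; first exact: HD.
      exact: H_sumD.
    - have [kj|kj] := eqVneq k j.
        by rewrite kj in Hb; exists b, 0; rewrite addr0; split=> //; exact: H_sum0.
      exists 0, b; rewrite add0r; split=> //; apply: (@H_sum_at _ k) => //.
      by rewrite /= mem_filter kj.
  move=> _ [t [h [Ht Hh ->]]]; apply: H_sumD; first exact: (@H_sum_at _ j).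
  by apply: sub_H_sum Hh => k; rewrite /= mem_filter => /andP[].
apply: locally_units_ideal.
- exact: H_at_subalgebra.
- exact: H_sum_subalgebra.
- by move=> t h; exact: H_sum_mul_minimal.
- exact: H_at_locally_full_matrix.
- exact: IH.
Qed.

Lemma H_sum_locally_units J : locally_units (H_sum J).
Proof.
move=> r rH.
have [s [sJ rs]] : exists s : seq I, [set` s] `<=` J /\
    forall x, x \in r -> H_sum [set` s] x.
  elim: r rH => [|x r IH] rH; first by exists [::].
  have [|s [sJ rs]] := IH; first by move=> y yr; apply: rH; rewrite inE yr orbT.
  have [s' [h [us' sP xE]]] := rH x (mem_head _ _).
  exists (s' ++ s); split=> [j /=|y].
    by rewrite mem_cat => /orP[/sP[]|/sJ].
  rewrite inE => /predU1P[->|/rs]; last first.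
    by apply: sub_H_sum => j /= js; rewrite mem_cat js orbT.
  by exists s', h; split=> // j js; have [_ Hj] := sP _ js; rewrite /= mem_cat js.
have [L [B [blk [e [eU eH gen]]]]] := H_sum_seq_locally_units rs.
exists L, B, blk, e; split=> // l m lm.
exact: sub_H_sum sJ _ (eH _ _ lm).
Qed.

End HSum.

Theorem proposition4p3
    (da : Order.disp_t) (aleph : bOrderType da) (K : fieldType)
    (d : Order.disp_t) (I : porderType d) :
  infinite_cardinal aleph ->
  aleph_poset aleph I ->
  (exists2 F : set I, finite_set F & cofinal F) ->
  (forall J : set I, locally_matricial (H_sum aleph K J)) /\
  locally_matricial (frakB aleph K I).
Proof.
move=> _ _ _; have H J : locally_matricial (H_sum aleph K J).
  by apply: locally_units_matricial; [exact: H_sum_subalgebra|exact: H_sum_locally_units].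
by split=> [J|]; exact: H.
Qed.
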